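(* Let $H$ be a separable infinite-dimensional Hilbert space, $\alpha:\mathcal B(H)\to\mathcal B(H)$ a non-zero endomorphism of index $n\in\{1,2,\dots,\infty\}$, and $\{U_i\}_{i=1}^n$ a family of isometries on $H$ with mutually orthogonal ranges such that $\alpha(a)=\sum_{i=1}^nU_iaU_i^*$ for all $a\in\mathcal B(H)$. An operator $\mathcal L:\mathcal B(H)\to\mathcal B(H)$ is a normal transfer operator for $(\mathcal B(H),\alpha)$ if and only if it is of the form $$\mathcal L(a)=\sum_{i,j=1}^n\rho(i,j)\,U_i^*aU_j,\qquad a\in\mathcal B(H),$$ where $\{\rho(i,j)\}_{i,j=1}^n$ is the matrix of a positive trace class operator $\rho$ on an $n$-dimensional Hilbert space $H_n$ (with respect to a fixed orthonormal basis), that is, $$\sum_{i,j}\rho(i,j)z_i\overline{z}_j\geq0\ \text{ for all } z_i\in\mathbb C,\ i=1,\dots,n,\qquad\text{and}\qquad \mathrm{Tr}\,\rho=\sum_{i=1}^n\rho(i,i)<\infty.$$ Moreover, $\|\mathcal L\|=\mathrm{Tr}\,\rho$, and $\mathcal L$ is non-degenerate if and only if $\mathrm{Tr}\,\rho=1$.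
   Context: An endomorphism is a $*$-homomorphism, not assumed to be unital. Every non-zero endomorphism $\alpha$ of $\mathcal B(H)$ ($H$ separable) is normal and can be written as $\alpha(a)=\sum_{i=1}^nU_iaU_i^*$ for some $n\in\{1,2,\dots,\infty\}$ (the index of $\alpha$; $n=\infty$ means indices $i\in\mathbb N$) and isometries $U_i\in\mathcal B(H)$ with mutually orthogonal ranges. When $n=\infty$, sums are weakly convergent (double sums being limits in the weak operator topology of the partial sums over $i,j\le N$ as $N\to\infty$), and in the positivity condition the families $(z_i)$ are finitely supported. A transfer operator for $(\mathcal B(H),\alpha)$ is a continuous positive linear map $\mathcal L:\mathcal B(H)\to\mathcal B(H)$ with $\mathcal L(\alpha(a)b)=a\mathcal L(b)$ for all $a,b\in\mathcal B(H)$; it is non-degenerate if $\alpha(\mathcal L(1))=\alpha(1)$. Normal means $\sigma$-weakly continuous. *)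

(* Defs.v *)
From HB Require Import structures.
From mathcomp Require Import all_boot all_order all_algebra.
From mathcomp Require Import complex.
From mathcomp Require Import all_classical all_reals all_analysis.

Set Implicit Arguments.
Unset Strict Implicit.
Unset Printing Implicit Defensive.

Import Order.TTheory GRing.Theory Num.Theory Num.Def.
Import numFieldNormedType.Exports.

Local Open Scope classical_set_scope.
Local Open Scope ring_scope.
Local Open Scope complex_scope.

(* [innerP] is linear in its first argument and conjugate-linear in the second. *)
HB.mixin Record CompleteNormedModule_isHilbert (R : realType) H
    of CompleteNormedModule R[i] H := {
  innerP : {dot H for (@conjC R[i])} ;
  innerP_norm : forall x : H, innerP x x = `|x| ^+ 2
}.

#[short(type="hilbertType")]
HB.structure Definition Hilbert (R : realType) :=
  {H of CompleteNormedModule R[i] H & CompleteNormedModule_isHilbert R H}.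

Definition inner (R : realType) (H : hilbertType R) (x y : H) : R[i] :=
  innerP x y.
Notation "''[' x , y ]" := (inner x y) (format "''[' x ,  y ]") : ring_scope.

Definition separable (T : topologicalType) :=
  exists2 D : set T, countable D & dense D.

Definition finite_dimensional (K : numFieldType) (V : lmodType K) :=
  exists (m : nat) (e : 'I_m -> V), forall x : V,
    exists c : 'I_m -> K, x = \sum_(i < m) c i *: e i.

Section opnorm.
Context {R : realType} {V W : normedModType R[i]}.

(* The norm of a normed module over [R[i]] takes its values in [R[i]], where
   no supremum is available, hence the (vacuous) real part. The set may fail to
   be bounded above for an arbitrary [f], in which case [sup] is the junk value
   0; boundedness is never to be read off from [opnorm]. *)
Definition opnorm (f : V -> W) : R :=
  sup [set complex.Re `|f x| | x in [set x : V | `|x| <= 1]].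

End opnorm.

Section Re_norm.
Context {R : realType} {V : normedModType R[i]}.

Lemma normRe (x : V) : `|x| = (complex.Re `|x|)%:C.
Proof.
have := normr_ge0 x; rewrite lecE /= => /andP[/eqP h _].
by move: h; case: `|x| => a b /= ->.
Qed.

Lemma Re_norm_ge0 (x : V) : 0 <= complex.Re `|x|.
Proof. by have := normr_ge0 x; rewrite lecE /= => /andP[]. Qed.

End Re_norm.

Section bounded_operators.
Context {R : realType} (H : hilbertType R).

Definition bounded_op : {pred (H -> H)} :=
  mem [set f : H -> H | linear f /\ continuous f].

Record BH := Bounded { op :> H -> H; _ : op \in bounded_op }.

HB.instance Definition _ := [isSub for op].
HB.instance Definition _ := [Choice of BH by <:].

Lemma bounded_op_submod : submod_closed bounded_op.
Proof.
split => [|a f g].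
  rewrite inE; split => [a x y|]; first by rewrite scaler0 addr0.
  exact: cst_continuous.
rewrite !inE => -[lf cf] [lg cg]; split => [b x y|x].
  rewrite !fctE lf lg !scalerDr !scalerA (mulrC b a) -!addrA; congr (_ + _).
  by rewrite addrCA.
by apply: cvgD; [apply: cvgZr; exact: cf|exact: cg].
Qed.

HB.instance Definition _ :=
  GRing.isSubmodClosed.Build R[i] (H -> H) bounded_op bounded_op_submod.
HB.instance Definition _ := [SubChoice_isSubLmodule of BH by <:].

Lemma BH_linear (a : BH) : linear a.
Proof. by case: a => f /= /[!inE] -[]. Qed.

Lemma BH_continuous (a : BH) : continuous a.
Proof. by case: a => f /= /[!inE] -[]. Qed.

HB.instance Definition _ (a : BH) :=
  GRing.isLinear.Build R[i] H H *:%R (op a) (BH_linear a).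

Lemma BHP (a b : BH) : op a =1 op b -> a = b.
Proof. by move=> ab; apply: val_inj; exact/funext. Qed.

Lemma BH_bounded (a : BH) :
  exists2 M : R, 0 <= M & forall x : H, `|a x| <= M%:C * `|x|.
Proof.
have := @BH_continuous a.
move=> /(linear_bounded_continuous (op a)) /linear_boundedP.
move=> /pinfty_ex_gt0[[M M'] M0 aM].
move: M0; rewrite ltcE /= => /andP[/eqP M'0 M0].
by exists M; [exact: ltW|move=> x; move: (aM x); rewrite M'0].
Qed.

Lemma opnorm_set_bounded (a : BH) :
  has_sup [set complex.Re `|a x| | x in [set x : H | `|x| <= 1]].
Proof.
split; first by exists (complex.Re `|a 0|), 0 => //=; rewrite normr0.
have [M M0 aM] := BH_bounded a.
exists M => _ [x /= x1 <-]; rewrite -lecR -normRe.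
by rewrite (le_trans (aM x))// -[leRHS]mulr1 ler_wpM2l// lecR.
Qed.

(* The operator norm, seen as a nonnegative element of [R[i]]. *)
Definition BHnorm (a : BH) : R[i] := (opnorm a)%:C.

Lemma opnorm_ub (a : BH) (x : H) :
  `|x| <= 1 -> complex.Re `|a x| <= opnorm a.
Proof.
by move=> x1; apply: sup_upper_bound; [exact: opnorm_set_bounded|exists x].
Qed.

Lemma opnorm_le (a : BH) (M : R) :
  (forall x : H, `|x| <= 1 -> complex.Re `|a x| <= M) ->
  opnorm a <= M.
Proof.
move=> aM; apply: ge_sup; first exact: (opnorm_set_bounded a).1.
by move=> _ [x /= x1 <-]; exact: aM.
Qed.

Lemma opnorm_ge0 (a : BH) : 0 <= opnorm a.
Proof.
apply: le_trans (opnorm_ub a (_ : `|0| <= 1)); last by rewrite normr0.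
exact: Re_norm_ge0.
Qed.

Lemma BHnormD (a b : BH) : BHnorm (a + b) <= BHnorm a + BHnorm b.
Proof.
rewrite /BHnorm -rmorphD lecR; apply: opnorm_le => x x1.
apply: (@le_trans _ _ (complex.Re (`|a x| + `|b x|))).
  by have := ler_normD (a x) (b x); rewrite lecE => /andP[].
by rewrite raddfD /= lerD// opnorm_ub.
Qed.

Lemma BHnormZ_le (l : R[i]) (a : BH) :
  BHnorm (l *: a) <= `|l| * BHnorm a.
Proof.
rewrite /BHnorm (normRe (l : R[i]^o)) -rmorphM lecR; apply: opnorm_le => x x1.
rewrite /= -lecR rmorphM -!normRe normrZ (normRe (a x)).
by apply: ler_wpM2l => //; rewrite lecR opnorm_ub.
Qed.

Lemma BHnormZ (l : R[i]) (a : BH) : BHnorm (l *: a) = `|l| * BHnorm a.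
Proof.
apply/eqP; rewrite eq_le BHnormZ_le /=.
have [->|l0] := eqVneq l 0.
  by rewrite normr0 mul0r lecR opnorm_ge0.
rewrite -ler_pdivlMl ?normr_gt0// -normfV.
by rewrite -{1}(scale1r a) -(mulVf l0) -scalerA BHnormZ_le.
Qed.

Lemma BHnorm0_eq0 (a : BH) : BHnorm a = 0 -> a = 0.
Proof.
move=> [a0]; apply: BHP => x /=.
have [->|x0] := eqVneq x 0; first exact: (linear0 (op a)).
have nx : `|x| != 0 by rewrite normr_eq0.
have x1 : `| `|x|^-1 *: x| <= 1 by rewrite normrZ normfV normr_id mulVf.
have := opnorm_ub a x1; rewrite a0 -lecR -normRe.
rewrite normr_le0 => /eqP /(congr1 (fun y => `|x| *: y)).
rewrite scaler0 (linearZ_LR (op a)).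
by rewrite scalerA divff// scale1r.
Qed.

HB.instance Definition _ :=
  Lmodule_isNormed.Build R[i] BH BHnormD BHnormZ BHnorm0_eq0.

Lemma bounded_op_id : id \in bounded_op.
Proof. by rewrite inE; split => // x; exact: cvg_id. Qed.

Definition BH1 : BH := Bounded bounded_op_id.

Lemma bounded_op_comp (a b : BH) : a \o b \in bounded_op.
Proof.
rewrite inE; split => [k x y /=|x]; first by rewrite !BH_linear.
by apply: continuous_comp; exact: BH_continuous.
Qed.

Definition BHmul (a b : BH) : BH := Bounded (bounded_op_comp a b).

Lemma BHmulA : associative BHmul. Proof. by move=> a b c; exact: BHP. Qed.
Lemma BHmul1l : left_id BH1 BHmul. Proof. by move=> a; exact: BHP. Qed.
Lemma BHmul1r : right_id BH1 BHmul. Proof. by move=> a; exact: BHP. Qed.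
Lemma BHmulDl : left_distributive BHmul +%R.
Proof. by move=> a b c; exact: BHP. Qed.
Lemma BHmulDr : right_distributive BHmul +%R.
Proof. by move=> a b c; apply: BHP => x; exact: (linearD (op a)). Qed.

HB.instance Definition _ := GRing.Zmodule_isPzRing.Build BH
  BHmulA BHmul1l BHmul1r BHmulDl BHmulDr.

End bounded_operators.

Section operator_notions.
Context {R : realType} {H : hilbertType R}.

(* The adjoint is unique, and exists by the Riesz representation theorem, so
   that the default value 0 is never used. *)
Definition adj (a : BH H) : BH H :=
  xget 0 [set b : BH H | forall x y : H, '[a x, y] = '[x, b y]].

Definition isometry_op (U : BH H) := forall x : H, `|U x| = `|x|.

Definition orthogonal_ranges (U V : BH H) := forall x y : H, '[U x, V y] = 0.

(* On [R[i]], [0 <= z] means that [z] is real and nonnegative. *)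
Definition positive_op (a : BH H) := forall x : H, 0 <= '[a x, x].

(* Convergence of sequences in the weak operator topology. *)
Definition wot_cvg (a_ : nat -> BH H) (a : BH H) := forall x y : H,
  (fun N => '[a_ N x, y] : R[i]^o) @ \oo --> ('[a x, y] : R[i]^o).

Definition square_summable (x : nat -> H) :=
  cvgn ([series `|x k| ^+ 2]_k : nat -> R[i]^o).

(* The functional [a |-> \sum_k <a x_k, y_k>]; when [x] and [y] are square
   summable the series converges absolutely. *)
Definition sigma_weak_form (xy : (nat -> H) * (nat -> H)) (a : BH H) : R[i]^o :=
  limn ([series '[a (xy.1 k), xy.2 k]]_k : nat -> R[i]^o).

Definition l2_pair := {xy : (nat -> H) * (nat -> H) |
  square_summable xy.1 /\ square_summable xy.2}.

(* [BH H] with the sigma-weak (ultraweak) topology, i.e. the coarsest topology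
   making all the functionals above continuous. *)
Definition sigma_weak := sup_topology (fun xy : l2_pair =>
  Topological.on (initial_topology (sigma_weak_form (sval xy)))).

HB.instance Definition _ := Topological.on sigma_weak.

Definition normal_map (L : BH H -> BH H) :=
  continuous (L : sigma_weak -> sigma_weak).

(* A *-homomorphism, not necessarily unital. *)
Definition endomorphism (alpha : BH H -> BH H) :=
  [/\ linear alpha,
      forall a b, alpha (a * b) = alpha a * alpha b &
      forall a, alpha (adj a) = adj (alpha a)].

Definition positive_map (L : BH H -> BH H) :=
  forall a, positive_op a -> positive_op (L a).

(* Continuity is with respect to the operator norm. *)
Definition transfer_operator (alpha L : BH H -> BH H) :=
  [/\ linear L, continuous L, positive_map L &
      forall a b, L (alpha a * b) = a * L b].

Definition normal_transfer_operator (alpha L : BH H -> BH H) :=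
  transfer_operator alpha L /\ normal_map L.

Definition nondegenerate_transfer (alpha L : BH H -> BH H) :=
  alpha (L 1) = alpha 1.

End operator_notions.
Arguments sigma_weak {R} H.

(* A cardinal n in {0, 1, ..., oo} is encoded as [Some m] (n = m) or [None]
   (n = oo). Families indexed by i = 1, ..., n are maps on [nat] (indices
   shifted to start at 0) of which only the values at [i] with [below n i]
   are used. *)
Definition below (n : option nat) (i : nat) : bool :=
  if n is Some m then (i < m)%N else true.

Section index_sums.
Context {R : realType} {H : hilbertType R}.

(* For finite [n] the sequences of partial sums below are eventually constant,
   so that their limits are the plain finite sums. *)

(* alpha(a) = \sum_i U_i a U_i^* *)
Definition implements (n : option nat) (U : nat -> BH H)
    (alpha : BH H -> BH H) :=
  forall a, wot_cvg
    (fun N => \sum_(i < N | below n i) U i * a * adj (U i)) (alpha a).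

(* L(a) = \sum_(i, j) rho(i, j) U_i^* a U_j *)
Definition transfer_form (n : option nat) (U : nat -> BH H)
    (rho : nat -> nat -> R[i]) (L : BH H -> BH H) :=
  forall a, wot_cvg
    (fun N => \sum_(i < N | below n i) \sum_(j < N | below n j)
                rho i j *: (adj (U i) * a * U j)) (L a).

(* Truncating at an arbitrary [N] amounts to taking finitely supported [z]. *)
Definition positive_matrix (n : option nat) (rho : nat -> nat -> R[i]) :=
  forall (N : nat) (z : nat -> R[i]),
    0 <= \sum_(i < N | below n i) \sum_(j < N | below n j)
           rho i j * z i * (z j)^*%C.

Definition trace_seq (n : option nat) (rho : nat -> nat -> R[i]) :
    nat -> R[i]^o :=
  fun N => \sum_(i < N | below n i) rho i i.

Definition trace (n : option nat) (rho : nat -> nat -> R[i]) : R[i] :=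
  limn (trace_seq n rho).

Definition positive_trace_class (n : option nat) (rho : nat -> nat -> R[i]) :=
  positive_matrix n rho /\ cvgn (trace_seq n rho).

End index_sums.

(* Main.v *)
(* Since [U_i U_j^*] commutes with [alpha a], their product being [U_i a U_j^*],
   a transfer operator sends [U_i U_j^*] to an operator commuting with
   everything, i.e. to a scalar [rho i j], and hence [U_i a U_j^*] to
   [rho i j *: a]. As L(b) = L(p b p) with [p = alpha 1] and [p_N b p_N] tends
   sigma-weakly to [p b p] for the projections [p_N = \sum_(i < N) U_i U_i^*],
   normality gives the double series for [L b]; positivity of [L] gives that of
   [rho], and [\sum_(i < N) rho i i] is bounded by [L 1].

   Conversely a Cholesky factorization [rho i j = \sum_m c m i * (c m j)^*] of
   the infinite matrix puts the series in Kraus form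
   [L a = \sum_m T_m^* a T_m] with [T_m = \sum_j (c m j)^* U_j], where
   [\sum_m |T_m|^2] is bounded by [Tr rho]. Positivity and the norm bound are
   then visible, and [\sum_k <L a x_k, y_k>] becomes the sigma-weak functional
   of the sequences [T_m x_k] and [T_m y_k], indexed by pairs (m, k). Finally
   [L 1 = Tr rho]. *)
From HB Require Import structures.
Require Import Defs.
From mathcomp Require Import all_boot all_order all_algebra.
From mathcomp Require Import complex.
From mathcomp Require Import all_classical all_reals all_analysis.
From mathcomp Require Import ring.
Import Order.TTheory GRing.Theory Num.Theory numFieldNormedType.Exports.
Set Implicit Arguments.
Unset Strict Implicit.
Unset Printing Implicit Defensive.
Local Open Scope classical_set_scope.
Local Open Scope ring_scope.
Local Open Scope complex_scope.

(** * Series of complex numbers *)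

Lemma conjE (R : realType) (z : R[i]) : Num.conj z = z^*%C.
Proof. by []. Qed.

Lemma conjcD (R : realType) (x y : R[i]) : (x + y)^*%C = x^*%C + y^*%C.
Proof. exact: rmorphD. Qed.

Lemma conjcN (R : realType) (x : R[i]) : (- x)^*%C = - x^*%C.
Proof. exact: rmorphN. Qed.

Lemma conjcB (R : realType) (x y : R[i]) : (x - y)^*%C = x^*%C - y^*%C.
Proof. exact: rmorphB. Qed.

Lemma conjcM (R : realType) (x y : R[i]) : (x * y)^*%C = x^*%C * y^*%C.
Proof. exact: rmorphM. Qed.

Lemma conjc_ge0 (R : realType) (x : R[i]) : 0 <= x -> x^*%C = x.
Proof. by move=> x0; rewrite -conjE; apply: CrealP; exact: ger0_real. Qed.

Lemma conjc_i (R : realType) : ('i%C : R[i])^*%C = - 'i%C.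
Proof. by apply/eqP; rewrite eq_complex /= oppr0 !eqxx. Qed.

Section complex_sequences.
Context {R : realType}.
Implicit Types (u v : nat -> R[i]^o) (l : R[i]^o) (d : nat -> R[i]).

(** A nonnegative sequence is its own sequence of norms, so by continuity of the norm its limit is
    its own norm. *)
Lemma cvgn_ge0 u l : (forall n, 0 <= u n) -> u @ \oo --> l -> 0 <= l.
Proof.
move=> u0 ul.
have ul' : u @ \oo --> (`|l| : R[i]^o).
  rewrite (_ : u = fun n => `|u n|); first exact: cvg_norm.
  by apply/funext => n; rewrite ger0_norm.
by rewrite (cvg_unique (@norm_hausdorff _ _) ul ul') normr_ge0.
Qed.

Lemma cvgn_le u v l (m : R[i]^o) : (forall n, u n <= v n) ->
  u @ \oo --> l -> v @ \oo --> m -> l <= m.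
Proof.
move=> uv ul vm; rewrite -subr_ge0.
by apply: (cvgn_ge0 _ (cvgB vm ul)) => n; rewrite subr_ge0.
Qed.

Lemma cvgn_norm_le u l (M : R[i]) :
  (forall n, `|u n| <= M) -> u @ \oo --> l -> `|l| <= M.
Proof.
move=> uM ul; apply: (cvgn_le uM _ (cvg_cst (M : R[i]^o))).
exact: (cvg_norm ul).
Qed.

Lemma cvgn_complex (f : nat -> R) (x : R) : f @ \oo --> x ->
  ((fun n => (f n)%:C) : nat -> R[i]^o) @ \oo --> (x%:C : R[i]^o).
Proof.
move=> /cvgrPdist_le fx; apply/cvgrPdist_le => e e0.
have eE : e = (complex.Re e)%:C by rewrite RRe_real// gtr0_real.
have Re0 : 0 < complex.Re e by rewrite -ltcR -eE.
near=> n; rewrite -rmorphB eE.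
have -> : `|((x - f n)%:C : R[i]^o)| = (`|x - f n|)%:C.
  by rewrite [LHS]normc_def /= expr0n addr0 sqrtr_sqr.
by rewrite lecR; near: n; exact: fx.
Unshelve. all: by end_near. Qed.

Lemma cauchy_seq_cvgn (K : numFieldType) (V : completeNormedModType K)
    (u : nat -> V) :
  (forall e : K, 0 < e -> exists N, forall m, (N <= m)%N -> `|u N - u m| < e) ->
  cvgn u.
Proof.
move=> h; apply: cauchy_cvg; apply: cauchy_exP => e e0.
have [N hN] := h _ e0; exists (u N); exists N => // m /= Nm.
by rewrite -ball_normE /=; exact: hN.
Qed.

(** Completeness is inherited from [R]: [Re] and [Im] are subtractive and do not increase the norm,
    so both parts of [u] are Cauchy. *)
Lemma complex_cauchy_cvgn u :
  (forall e : R[i], 0 < e -> exists N, forall m, (N <= m)%N -> `|u N - u m| < e) ->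
  cvgn u.
Proof.
move=> h.
have part (g : R[i] -> R) : {morph g : x y / x - y} ->
    (forall z : R[i], (`|g z|)%:C <= `|z|) -> cvgn (g \o u).
  move=> gB gn; apply: (@cauchy_seq_cvgn R R) => e e0.
  have [|N hN] := h e%:C; first by rewrite ltcR.
  exists N => m /hN; rewrite -ltcR; apply: le_lt_trans.
  by rewrite -gB; exact: gn.
have Im_le (z : R[i]) : (`|complex.Im z|)%:C <= `|z|.
  have := normc_ge_Re (z * 'i%C).
  by rewrite ReiNIm normrN normrM complexiE normCi mulr1.
have /cvg_ex[a /= ua] := part (@complex.Re R) (@raddfB _ _ _) (@normc_ge_Re R).
have /cvg_ex[b /= ub] := part (@complex.Im R) (@raddfB _ _ _) Im_le.
have ca := cvgn_complex ua; have cb := cvgn_complex ub.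
rewrite (_ : u = (fun n => (complex.Re (u n))%:C) +
                 (fun n => 'i%C * (complex.Im (u n))%:C)); last first.
  by apply/funext => n; rewrite [LHS]complexE.
apply: (cvgP (a%:C + 'i%C * b%:C : R[i]^o)).
apply: cvgD; first exact: ca.
by apply: cvgM; [exact: cvg_cst|exact: cb].
Qed.

(** Being comparable with 0 makes the terms and [M] real, so monotone convergence in [R] applies to
    the real parts. *)
Lemma nondecreasing_bounded_cvgn u (M : R[i]) :
  (forall n, 0 <= u n) -> (forall n, u n <= u n.+1) -> (forall n, u n <= M) ->
  cvgn u.
Proof.
move=> u0 uS uM.
have uE n : u n = (complex.Re (u n))%:C by rewrite RRe_real// ger0_real.
have ME : M = (complex.Re M)%:C.
  by rewrite RRe_real// ger0_real// (le_trans (u0 0%N)).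
have /cvg_ex[x /= ux] : cvgn (fun n => complex.Re (u n)).
  apply: nondecreasing_is_cvgn.
    by apply/nondecreasing_seqP => n; rewrite -lecR -!uE.
  by exists (complex.Re M) => _ [n _ <-]; rewrite -lecR -ME -uE.
apply: (@cvgP _ _ (x%:C : R[i]^o)).
rewrite (_ : u = fun n => (complex.Re (u n))%:C) ?funeqE//.
exact: cvgn_complex.
Qed.

Lemma nondecreasing_cvgn_ub u l : (forall n, u n <= u n.+1) ->
  u @ \oo --> l -> forall n, u n <= l.
Proof.
move=> uS ul n.
apply: (@cvgn_le (cst (u n)) (fun k => u (k + n)%N)); last by rewrite cvg_shiftn.
  by move=> k; elim: k => [|k IH] //=; apply: le_trans IH (uS _).
exact: cvg_cst.
Qed.

(** The partial sums increase to a limit [l]; once one of them is within [e] of [l], all later ones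
    stay in between. *)
Lemma nneg_tail d (M : R[i]) : (forall k, 0 <= d k) ->
  (forall n, \sum_(k < n) d k <= M) ->
  forall e : R[i], 0 < e ->
  exists P, forall Q, \sum_(P <= k < Q) d k < e.
Proof.
move=> d0 dM e e0.
pose s : nat -> R[i]^o := fun n => \sum_(0 <= k < n) d k.
have sS n : s n <= s n.+1 by rewrite /s big_nat_recr//= lerDl.
have /cvg_ex[l /= sl] : cvgn s.
  apply: (@nondecreasing_bounded_cvgn _ M) => // n; last by rewrite /s big_mkord.
  by apply: sumr_ge0.
have sub := nondecreasing_cvgn_ub sS sl.
have /cvgrPdist_lt/(_ _ e0)[P _ hP] := sl.
exists P => Q; have [QP|PQ] := leqP Q P; first by rewrite big_geq.
have -> : \sum_(P <= k < Q) d k = s Q - s P.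
  by rewrite /s (big_cat_nat (leq0n P) (ltnW PQ))/= addrAC subrr add0r.
apply: le_lt_trans (hP P (leqnn P)).
by rewrite ger0_norm ?subr_ge0// lerD2r.
Qed.

Lemma abs_series_cvgn u d (M : R[i]) : (forall k, `|u k| <= d k) ->
  (forall n, \sum_(k < n) d k <= M) -> cvgn (series u).
Proof.
move=> ud dM.
have d0 k : 0 <= d k by apply: le_trans (ud k).
apply: complex_cauchy_cvgn => e e0.
have [P hP] := nneg_tail d0 dM e0; exists P => Q PQ.
rewrite distrC sub_series_geq//.
apply: le_lt_trans (hP Q); apply: le_trans (ler_norm_sum _ _ _) _.
exact: ler_sum.
Qed.

Lemma cvgn_sum (K : numFieldType) (V : normedModType K) (I : Type)
    (r : seq I) (P : pred I) (f : I -> nat -> V) (a : I -> V) :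
  (forall i, P i -> f i @ \oo --> a i) ->
  (fun n => \sum_(i <- r | P i) f i n) @ \oo --> \sum_(i <- r | P i) a i.
Proof.
by move=> fa; apply: cvg_big => //; exact: add_continuous.
Qed.

(* Tannery's theorem, i.e. dominated convergence for series. *)
Lemma tannery (g : nat -> nat -> R[i]^o) (l : nat -> R[i]^o) d (M : R[i]) :
  (forall N k, `|g N k| <= d k) -> (forall n, \sum_(k < n) d k <= M) ->
  (forall k, (fun N => g N k) @ \oo --> l k) ->
  (fun N => limn (series (g N))) @ \oo --> limn (series l).
Proof.
move=> gd dM gl.
have ld k : `|l k| <= d k by apply: cvgn_norm_le (gl k) => N; exact: gd.
have d0 k : 0 <= d k by apply: le_trans (ld k).
have cg N := abs_series_cvgn (gd N) dM.
have cl := abs_series_cvgn ld dM.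
apply/cvgrPdist_le => e e0.
(* Three errors of at most [e / 4]: the first [P] terms, and the tails of [l] and of [g N] past [P].
   They are estimated up to [Q + P], and then [Q] goes to infinity. *)
have e4 : 0 < e / 4%:R by rewrite divr_gt0.
have [P hP] := nneg_tail d0 dM e4.
have : (fun N => series (g N) P) @ \oo --> series l P.
  by rewrite /series /=; apply: cvgn_sum => k _; exact: gl.
move=> /cvgrPdist_le/(_ _ e4)[N0 _ hN]; exists N0 => // N /= NN0.
apply: (@cvgn_norm_le (fun Q => series l (Q + P)%N - series (g N) (Q + P)%N)).
  move=> Q; set A := series l; set B := series (g N).
  have -> : A (Q + P)%N - B (Q + P)%N =
      (A P - B P) + ((A (Q + P)%N - A P) - (B (Q + P)%N - B P)).
    by rewrite opprB addrACA [X in _ = X + _]addrC subrK addKr.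
  have tail (f : nat -> R[i]^o) : (forall k, `|f k| <= d k) ->
      `|series f (Q + P)%N - series f P| <= e / 4%:R.
    move=> fd; rewrite sub_series_geq ?leq_addl//.
    apply: ltW; apply: le_lt_trans (hP (Q + P)%N).
    by apply: le_trans (ler_norm_sum _ _ _) _; exact: ler_sum.
  apply: le_trans (ler_normD _ _) _.
  apply: (@le_trans _ _ (e / 4%:R + (e / 4%:R + e / 4%:R))).
    apply: lerD; first exact: hN.
    by apply: le_trans (ler_normB _ _) _; apply: lerD; exact: tail.
  rewrite -!mulrDl -[leRHS](mulfK (_ : 4%:R != 0 :> R[i])) ?pnatr_eq0//.
  by rewrite ler_pM2r ?invr_gt0// mulr_natr !mulrS mulr0n addr0 !lerD2l lerDl ltW.
by apply: cvgB; [rewrite (cvg_shiftn P (series l))|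
  rewrite (cvg_shiftn P (series (g N)))]; [exact: cl|exact: cg].
Qed.

End complex_sequences.

(** * Inner products and adjoints *)

Section sesquilinear_forms.
Context {R : realType} {V : lmodType R[i]}.
Variable f : V -> V -> R[i].
Hypotheses (fDl : forall u v w, f (u + v) w = f u w + f v w)
  (fDr : forall u v w, f w (u + v) = f w u + f w v)
  (fZl : forall c u w, f (c *: u) w = c * f u w)
  (fZr : forall c u w, f w (c *: u) = c^*%C * f w u).

Let fNl u w : f (- u) w = - f u w.
Proof. by rewrite -scaleN1r fZl mulN1r. Qed.

Let fNr u w : f w (- u) = - f w u.
Proof. by rewrite -scaleN1r fZr rmorphN rmorph1 mulN1r. Qed.

Lemma polarization x y :
  4%:R * f x y = f (x + y) (x + y) - f (x - y) (x - y) +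
     'i%C * (f (x + 'i%C *: y) (x + 'i%C *: y) -
             f (x - 'i%C *: y) (x - 'i%C *: y)).
Proof.
rewrite !fDl !fDr !fNl !fNr !fZl !fZr.
rewrite conjc_i.
have := sqr_i R.
(* ['i] becomes a variable for [ring]; the relation [i ^+ 2 = -1] is inserted by hand in the two
   places where the expansion produces [i ^+ 2]. *)
move: ('i%C : R[i]) => i i2.
set a := f x x; set b := f y y; set c := f x y; set d := f y x.
have -> : 4%:R * c = 2%:R * c - 2%:R * (i ^+ 2) * c by rewrite i2; ring.
have di : 2%:R * d + 2%:R * i ^+ 2 * d = 0 by rewrite i2; ring.
by rewrite -[LHS]addr0 -di; ring.
Qed.

Hypothesis f0 : forall u, 0 <= f u u.

(** The diagonal values are real, so conjugating the polarization identity for [(x, y)] only changes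
    the sign of its second half. Since [y + i x = i (x - i y)] and [f (i u) (i u) = f u u], this is
    the identity for [(y, x)]. *)
Lemma psd_hermitian x y : f y x = (f x y)^*%C.
Proof.
have n4 : (4%:R : R[i]) != 0 by rewrite pnatr_eq0.
apply: (mulfI n4); rewrite -[4%:R in RHS](conjc_nat _ 4) -conjcM !polarization.
rewrite !(conjcD, conjcN, conjcM) !(conjc_ge0 (f0 _)).
rewrite conjc_i.
have sw (u : V) : f ('i%C *: u) ('i%C *: u) = f u u.
  by rewrite fZl fZr mulrA -sqr_normc complexiE normCi expr1n mul1r.
have ii : 'i%C * 'i%C = -1 :> R[i] by rewrite -expr2 sqr_i.
rewrite [y + x]addrC -[y - x]opprB fNl fNr opprK.
rewrite -(sw (x + 'i%C *: y)) -(sw (x - 'i%C *: y)).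
rewrite !scalerDr !scalerN scalerA ii !scaleN1r opprK.
rewrite ['i%C *: x + y]addrC.
rewrite -['i%C *: x - y]opprB fNl fNr opprK; ring.
Qed.

Lemma psd_cauchy_schwarz x y : `|f x y| ^+ 2 <= f x x * f y y.
Proof.
(* If only [f y y] vanishes, [x] and [y] are exchanged. If both diagonal values vanish, positivity
   at [x - f x y *: y] reads [- 2 |f x y|^2 >= 0]. *)
wlog y0 : x y / f y y != 0 => [h|].
  have [y0|/h//] := eqVneq (f y y) 0.
  have [x0|x0] := eqVneq (f x x) 0; last first.
    by rewrite psd_hermitian normcJ mulrC; exact: h.
  have := f0 (x - f x y *: y); rewrite fDl !fDr !fNl !fNr !fZl !fZr x0 y0.
  rewrite [X in 0 <= X](_ : _ = - (f x y * (f x y)^*%C *+ 2)); last first.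
    by rewrite (psd_hermitian x y); ring.
  by rewrite mulr0 -sqr_normc oppr_ge0 pmulrn_lle0.
have yp : 0 < f y y by rewrite lt0r y0 f0.
rewrite -subr_ge0 -(pmulr_rge0 _ yp).
(* The value here is [f y y] times [f x x * f y y - |f x y|^2]. *)
have := f0 (f y y *: x - f x y *: y).
rewrite fDl !fDr !fNl !fNr !fZl !fZr (psd_hermitian x y) (conjc_ge0 (f0 y)).
rewrite sqr_normc.
by congr (0 <= _); ring.
Qed.

End sesquilinear_forms.

Section inner_product.
Context {R : realType} {H : hilbertType R}.
Implicit Types (x y z : H) (k : R[i]).

Lemma innerDl x y z : '[x + y, z] = '[x, z] + '[y, z].
Proof. exact: linearDl. Qed.

Lemma innerZl k x z : '[k *: x, z] = k * '[x, z].
Proof. exact: linearZl_LR. Qed.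

Lemma innerDr x y z : '[z, x + y] = '[z, x] + '[z, y].
Proof. exact: linearDr. Qed.

Lemma innerZr k x z : '[z, k *: x] = k^*%C * '[z, x].
Proof. exact: linearZr_LR. Qed.

Lemma innerC x y : '[x, y] = '[y, x]^*%C.
Proof. by rewrite /inner hermC expr0 mul1r. Qed.

Lemma innerNl x z : '[- x, z] = - '[x, z].
Proof. by rewrite -scaleN1r innerZl mulN1r. Qed.

Lemma innerNr x z : '[z, - x] = - '[z, x].
Proof. by rewrite -scaleN1r innerZr rmorphN rmorph1 mulN1r. Qed.

Lemma innerBl x y z : '[x - y, z] = '[x, z] - '[y, z].
Proof. by rewrite innerDl innerNl. Qed.

Lemma inner0l z : '[0, z] = 0.
Proof. by rewrite -(scale0r 0) innerZl mul0r. Qed.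

Lemma inner0r z : '[z, 0] = 0.
Proof. by rewrite innerC inner0l rmorph0. Qed.

Lemma inner_suml I (r : seq I) (P : pred I) (f : I -> H) z :
  '[\sum_(i <- r | P i) f i, z] = \sum_(i <- r | P i) '[f i, z].
Proof.
by elim/big_rec2: _ => [|i u v _ <-]; rewrite ?inner0l ?innerDl.
Qed.

Lemma inner_sumr I (r : seq I) (P : pred I) (f : I -> H) z :
  '[z, \sum_(i <- r | P i) f i] = \sum_(i <- r | P i) '[z, f i].
Proof.
by elim/big_rec2: _ => [|i u v _ <-]; rewrite ?inner0r ?innerDr.
Qed.

Lemma innerxx x : '[x, x] = `|x| ^+ 2.
Proof. exact: innerP_norm. Qed.

Lemma innerxx_ge0 x : 0 <= '[x, x].
Proof. by rewrite innerxx exprn_ge0. Qed.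

Lemma innerxx_eq0 x : ('[x, x] == 0) = (x == 0).
Proof. by rewrite innerxx sqrf_eq0 normr_eq0. Qed.

Lemma inner_eq x y : (forall z, '[x, z] = '[y, z]) -> x = y.
Proof.
move=> h; apply/eqP; rewrite -subr_eq0 -innerxx_eq0 innerBl h subrr.
exact: eqxx.
Qed.

Lemma sqr_normD x y :
  `|x + y| ^+ 2 = `|x| ^+ 2 + `|y| ^+ 2 + ('[x, y] + '[x, y]^*%C).
Proof.
rewrite -!innerxx !innerDl !innerDr [in '[y, x]]innerC.
by rewrite [X in _ + X]addrC addrACA.
Qed.

Lemma cauchy_schwarz x y : `|'[x, y]| <= `|x| * `|y|.
Proof.
rewrite -(@ler_pXn2r _ 2)// ?nnegrE ?mulr_ge0// exprMn -!innerxx.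
apply: psd_cauchy_schwarz => //.
- exact: innerDl.
- by move=> u v w; exact: innerDr.
- exact: innerZl.
- by move=> k u w; exact: innerZr.
- exact: innerxx_ge0.
Qed.

End inner_product.

Lemma linear_le_continuous (K : numFieldType) (V W : normedModType K)
    (f : V -> W) (M : K) :
  0 <= M -> linear f -> (forall x, `|f x| <= M * `|x|) -> continuous f.
Proof.
move=> M0 fl fM.
pose fL : {linear V -> W} := HB.pack f (GRing.isLinear.Build K V W *:%R f fl).
apply/(@linear_bounded_continuous _ _ _ fL)/linear_boundedP.
exists M; split; first exact: ger0_real.
by move=> r Mr x; apply: le_trans (fM x) _; rewrite ler_wpM2r// ltW.
Qed.

(** * Bounded operators: weak evaluation, Riesz representation and adjoints *)

Section bounded_operator_theory.
Context {R : realType} {H : hilbertType R}.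
Implicit Types (x y z : H) (k : R[i]) (a b : BH H).

(** Polarization expresses the inner product through norms, which are continuous. *)
Lemma cvg_inner (u v : nat -> H) x y : u @ \oo --> x -> v @ \oo --> y ->
  (fun n => '[u n, v n] : R[i]^o) @ \oo --> ('[x, y] : R[i]^o).
Proof.
move=> ux vy.
have pol (s t : H) : '[s, t] = 4%:R^-1 * (`|s + t| ^+ 2 - `|s - t| ^+ 2 +
    'i%C * (`|s + 'i%C *: t| ^+ 2 - `|s - 'i%C *: t| ^+ 2)).
  have := @polarization _ _ (fun s t => '[s, t]) innerDl
    (fun u v w => innerDr u v w) innerZl (fun k u w => innerZr k u w) s t.
  by rewrite !innerxx => <-; rewrite mulKf// pnatr_eq0.
have sqr (f : nat -> H) z : f @ \oo --> z ->
    (fun n => `|f n| ^+ 2 : R[i]^o) @ \oo --> (`|z| ^+ 2 : R[i]^o).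
  by move=> fz; apply: cvgM; exact: cvg_norm.
rewrite pol (_ : (fun n => _) = fun n => 4%:R^-1 * (`|u n + v n| ^+ 2 -
  `|u n - v n| ^+ 2 + 'i%C * (`|u n + 'i%C *: v n| ^+ 2 -
  `|u n - 'i%C *: v n| ^+ 2)) : R[i]^o); last by apply/funext => n; exact: pol.
have iv : (fun n => 'i%C *: v n) @ \oo --> 'i%C *: y by apply: cvgZr.
apply: cvgM; first exact: cvg_cst.
apply: cvgD; first by apply: cvgB; apply: sqr; [apply: cvgD|apply: cvgB].
apply: cvgM; first exact: cvg_cst.
by apply: cvgB; apply: sqr; [apply: cvgD|apply: cvgB].
Qed.

Lemma BHE_add a b x : (a + b) x = a x + b x. Proof. by []. Qed.
Lemma BHE_opp a x : (- a) x = - a x. Proof. by []. Qed.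
Lemma BHE_scale k a x : (k *: a) x = k *: a x. Proof. by []. Qed.
Lemma BHE_mul a b x : (a * b) x = a (b x). Proof. by []. Qed.
Lemma BHE_one x : (1 : BH H) x = x. Proof. by []. Qed.
Lemma BHE_sum I (r : seq I) (P : pred I) (f : I -> BH H) x :
  (\sum_(i <- r | P i) f i) x = \sum_(i <- r | P i) f i x.
Proof. by elim/big_rec2: _ => [|i u v _ <-]. Qed.

Lemma BH_eq a b : (forall x y, '[a x, y] = '[b x, y]) -> a = b.
Proof. by move=> ab; apply: BHP => x; apply: inner_eq => z; exact: ab. Qed.

Lemma BH_eq_diag a b : (forall x, '[a x, x] = '[b x, x]) -> a = b.
Proof.
move=> ab; apply: BH_eq => x y.
have pol (c : BH H) : 4%:R * '[c x, y] = '[c (x + y), x + y] -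
    '[c (x - y), x - y] + 'i%C * ('[c (x + 'i%C *: y), x + 'i%C *: y] -
    '[c (x - 'i%C *: y), x - 'i%C *: y]).
  apply: (@polarization _ _ (fun s t => '[c s, t])) => [u v w|u v w|k u w|k u w].
  - by rewrite (linearD (op c)) innerDl.
  - by rewrite innerDr.
  - by rewrite (linearZ_LR (op c)) innerZl.
  - by rewrite innerZr.
have n4 : (4%:R : R[i]) != 0 by rewrite pnatr_eq0.
by apply: (mulfI n4); rewrite !pol !ab.
Qed.

Lemma le_BHnorm a x : `|a x| <= `|a| * `|x|.
Proof.
have [->|x0] := eqVneq x 0; first by rewrite (linear0 (op a)) !normr0 mulr0.
have nx : 0 < `|x| by rewrite normr_gt0.
have nu : `| `|x|^-1 *: x| <= 1.
  by rewrite normrZ normfV normr_id mulVf ?lt0r_neq0.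
have := opnorm_ub a nu.
rewrite -lecR -normRe (linearZ_LR (op a)) normrZ normfV normr_id.
by rewrite ler_pdivrMl// mulrC.
Qed.

(* Riesz representation: the representing vector is the limit of a sequence
   minimizing |x|^2 - 2 Re (f x), which is Cauchy by the parallelogram law. *)
Lemma riesz (f : H -> R[i]) (M : R) :
  (forall x y, f (x + y) = f x + f y) -> (forall k x, f (k *: x) = k * f x) ->
  (forall x, `|f x| <= M%:C * `|x|) ->
  exists u, forall x, f x = '[x, u].
Proof.
move=> fD fZ fM.
pose J x : R[i] := `|x| ^+ 2 - (f x + (f x)^*%C).
have JR x : J x \is Num.real.
  rewrite /J addcJ; apply: realB; first by apply: realX; exact: normr_real.
  by apply: realM; [exact: realn|apply/complex_realP; eexists].
have JE x : J x = (complex.Re (J x))%:C by rewrite RRe_real.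
pose S := range (fun x => complex.Re (J x)).
have S0 : S !=set0 by exists (complex.Re (J 0)), 0.
(* [J x >= |x|^2 - 2 M |x| = (|x| - M)^2 - M^2]. *)
have J_lb x : (- M ^+ 2)%:C <= J x.
  have fle : f x + (f x)^*%C <= 2%:R * (M%:C * `|x|).
    rewrite addcJ ler_pM2l//; apply: le_trans (fM x).
    by apply: le_trans (normc_ge_Re _); rewrite lecR ler_norm.
  apply: le_trans (_ : `|x| ^+ 2 - 2%:R * (M%:C * `|x|) <= _); last by rewrite lerD2l lerN2.
  rewrite -subr_ge0 (_ : _ - _ = (`|x| - M%:C) ^+ 2).
    rewrite normRe -rmorphB -rmorphXn -(rmorph0 (real_complex R)) lecR.
    exact: sqr_ge0.
  by rewrite rmorphN rmorphXn/=; ring.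
have lbS : has_lbound S.
  by exists (- M ^+ 2) => _ [x _ <-]; rewrite -lecR -JE.
pose m : R[i] := (inf S)%:C.
have mJ x : m <= J x by rewrite JE lecR; apply: ge_inf => //; exists x.
have approx n : exists x, J x < m + n.+1%:R^-1.
  have n0 : (0 : R) < n.+1%:R^-1 by rewrite invr_gt0.
  have [_ [x _ <-] xlt] := inf_adherent n0 (conj S0 lbS).
  exists x; rewrite JE (_ : m + _ = (inf S + n.+1%:R^-1)%:C) ?ltcR//.
  by rewrite rmorphD/= fmorphV rmorph_nat.
have [x_ xJ] := choice approx.
(* By the parallelogram law the difference of the two sides is [4 (J ((x + y) / 2) - m)]. *)
have par x y : `|x - y| ^+ 2 <= 2%:R * (J x - m) + 2%:R * (J y - m).
  have := mJ (2%:R^-1 *: (x + y)).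
  rewrite {1}/J fZ fD normrZ normfV normr_nat exprMn => mid.
  have {}mid := ler_wpM2l (ler0n _ 4) mid.
  rewrite -subr_ge0 in mid; rewrite -subr_ge0.
  apply: le_trans mid _; rewrite le_eqVlt; apply/orP; left; apply/eqP.
  have -> : (2%:R^-1 * (f x + f y))^*%C = 2%:R^-1 * ((f x)^*%C + (f y)^*%C).
    by rewrite rmorphM rmorphD fmorphV rmorph_nat.
  rewrite /J !sqr_normD normrN innerNr rmorphN.
  by field.
have /cvg_ex[u /= xu] : cvgn x_.
  apply: cauchy_seq_cvgn => e e0.
  have eE : e ^+ 2 / 4%:R = (complex.Re (e ^+ 2 / 4%:R))%:C.
    by rewrite RRe_real// gtr0_real// divr_gt0 ?exprn_gt0.
  have [N] : exists k : nat, 0 + k.+1%:R^-1 < complex.Re (e ^+ 2 / 4%:R).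
    by apply: ltr_add_invr; rewrite -ltcR -eE divr_gt0 ?exprn_gt0.
  rewrite add0r -ltcR -eE fmorphV rmorph_nat => Ne; exists N => k Nk.
  rewrite -(@ltr_pXn2r _ 2)// ?nnegrE ?normr_ge0 ?ltW//.
  apply: le_lt_trans (par _ _) _.
  have dist j : (N <= j)%N -> J (x_ j) - m <= N.+1%:R^-1.
    move=> Nj; rewrite lerBlDl; apply: le_trans (ltW (xJ j)) _.
    by rewrite lerD2l lef_pV2 ?posrE// ler_nat.
  apply: (@le_lt_trans _ _ (4%:R * N.+1%:R^-1)); last first.
    by rewrite -ltr_pdivlMl// mulrC.
  have -> : 4%:R * N.+1%:R^-1 = 2%:R * N.+1%:R^-1 + 2%:R * N.+1%:R^-1 :> R[i].
    by rewrite -mulrDl -natrD.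
  by apply: lerD; rewrite ler_pM2l// dist.
exists u => v.
pose w n : R[i]^o := '[v, x_ n] - f v.
(* [w n] is the failure of [x_ n] to represent [f] at [v]. Moving [x_ n] by [- s (w n)^* v] lowers
   [J] by [(s + s^2) |w n|^2], which cannot exceed the excess of [J (x_ n)] over [m]. The [+ 1] in
   [s] covers [v = 0]. *)
have wle n : `|w n| ^+ 2 <= n.+1%:R^-1 * (`|v| ^+ 2 + 1).
  pose s : R[i] := (`|v| ^+ 2 + 1)^-1.
  have d0 : 0 < `|v| ^+ 2 + 1 by rewrite ltr_wpDl// exprn_ge0.
  have s0 : 0 < s by rewrite invr_gt0.
  have sJ : s^*%C = s by apply: conjc_ge0; exact: ltW.
  have JE' : J (x_ n - (s * (w n)^*%C) *: v) =
      J (x_ n) - (s + s ^+ 2) * `|w n| ^+ 2.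
    have fvE : f v = '[v, x_ n] - w n by rewrite opprB addrC subrK.
    rewrite /J.
    clearbody w; move: (w n) fvE => W fvE.
    have -> : f (x_ n - (s * W^*%C) *: v) = f (x_ n) - s * W^*%C * f v.
      by rewrite -scaleNr fD fZ mulNr.
    have sN : s * `|v| ^+ 2 = 1 - s.
      by apply/eqP; rewrite eq_sym subr_eq -[X in _ + X]mulr1 -mulrDr mulVf ?lt0r_neq0.
    rewrite sqr_normD normrN normrZ exprMn !sqr_normc conjcM conjcK sJ.
    rewrite innerNr innerZr conjcM conjcK sJ (innerC (x_ n)) fvE.
    rewrite !(conjcB, conjcM, conjcN) !conjcK sJ.
    apply/eqP; rewrite -subr_eq0; apply/eqP.
    rewrite [LHS](_ : _ = s * W * W^*%C * (s * `|v| ^+ 2 - (1 - s))); last by ring.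
    by rewrite sN subrr mulr0.
  have sw : (s + s ^+ 2) * `|w n| ^+ 2 <= n.+1%:R^-1.
    apply: (@le_trans _ _ (J (x_ n) - m)); last by rewrite lerBlDl ltW.
    have := mJ (x_ n - (s * (w n)^*%C) *: v).
    by rewrite JE' lerBrDr -lerBrDl.
  rewrite -ler_pdivrMr// mulrC; apply: le_trans sw.
  by rewrite ler_wpM2r ?exprn_ge0// lerDl exprn_ge0// ltW.
have wl : w @ \oo --> ('[v, u] - f v : R[i]^o).
  by apply: cvgB; [apply: cvg_inner => //; exact: cvg_cst|exact: cvg_cst].
have : `|'[v, u] - f v| ^+ 2 <= 0 * (`|v| ^+ 2 + 1).
  apply: (cvgn_le wle); first by apply: cvgM; exact: cvg_norm.
  apply: cvgM; last exact: cvg_cst.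
  have := cvgn_complex (@cvg_harmonic R).
  rewrite rmorph0 (_ : (fun n => (harmonic n)%:C) = (fun n => n.+1%:R^-1))//.
  by apply/funext => n; rewrite fmorphV rmorph_nat.
rewrite mul0r => wl0; apply/eqP; rewrite eq_sym -subr_eq0 -normr_eq0 -sqrf_eq0.
by rewrite eq_le wl0 exprn_ge0.
Qed.

(** Riesz representation of [x |-> '[a x, y]] for each [y]; the bound on [b] follows from [|b y|^2 =
    '[a (b y), y]]. *)
Lemma adjop_ex a : exists b, forall x y, '[a x, y] = '[x, b y].
Proof.
have [M M0 aM] := BH_bounded a.
have M0C : 0 <= M%:C by rewrite lecR.
have /choice[b bE] y : exists u, forall x, '[a x, y] = '[x, u].
  apply: (@riesz _ (M * complex.Re `|y|)) => [u v|k u|x].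
  - by rewrite (linearD (op a)) innerDl.
  - by rewrite (linearZ_LR (op a)) innerZl.
  - apply: le_trans (cauchy_schwarz _ _) _; rewrite rmorphM/= -normRe.
    by rewrite mulrAC ler_wpM2r.
have bl : linear b.
  move=> k u v; apply: inner_eq => z; rewrite innerC -bE.
  rewrite innerDr innerZr !bE rmorphD rmorphM/= conjcK.
  by rewrite innerDl innerZl -!innerC.
have bb y : `|b y| <= M%:C * `|y|.
  have [->|by0] := eqVneq (b y) 0; first by rewrite normr0 mulr_ge0// lecR.
  have b0 : 0 < `|b y| by rewrite normr_gt0.
  rewrite -(ler_pM2l b0) -expr2 -innerxx -bE.
  have -> : '[a (b y), y] = `|'[a (b y), y]|.
    by rewrite bE innerxx ger0_norm ?exprn_ge0.
  apply: le_trans (cauchy_schwarz _ _) _.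
  by rewrite mulrA ler_wpM2r// mulrC.
have bc : continuous b.
  exact: linear_le_continuous M0C bl bb.
have bin : b \in @bounded_op R H by rewrite inE.
by exists (Bounded bin) => x y; rewrite bE.
Qed.

Lemma adjopP a x y : '[a x, y] = '[x, adj a y].
Proof.
have [b bP] := adjop_ex a.
rewrite /adj; case: xgetP => [c _ cP|nP]; first exact: cP.
by have := nP b bP.
Qed.

Lemma adjopPl a x y : '[adj a x, y] = '[x, a y].
Proof. by rewrite innerC -adjopP -innerC. Qed.

Lemma adjop_unique a b : (forall x y, '[a x, y] = '[x, b y]) -> b = adj a.
Proof.
by move=> ab; apply: BH_eq => x y; rewrite adjopPl innerC -ab -innerC.
Qed.

Lemma adjopK a : adj (adj a) = a.
Proof. by apply/esym/adjop_unique => x y; exact: adjopPl. Qed.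

Lemma adjopD a b : adj (a + b) = adj a + adj b.
Proof.
by apply/esym/adjop_unique => x y; rewrite !BHE_add innerDl innerDr !adjopP.
Qed.

Lemma adjopZ k a : adj (k *: a) = k^*%C *: adj a.
Proof.
apply/esym/adjop_unique => x y.
by rewrite !BHE_scale innerZl innerZr conjcK adjopP.
Qed.

Lemma adjopM a b : adj (a * b) = adj b * adj a.
Proof. by apply/esym/adjop_unique => x y; rewrite !BHE_mul !adjopP. Qed.

Lemma adjop0 : adj (0 : BH H) = 0.
Proof. by apply/esym/adjop_unique => x y; rewrite inner0l inner0r. Qed.

Lemma adjop1 : adj (1 : BH H) = 1.
Proof. by apply/esym/adjop_unique. Qed.

Lemma adjopB a b : adj (a - b) = adj a - adj b.
Proof. by rewrite adjopD -scaleN1r adjopZ rmorphN rmorph1 scaleN1r. Qed.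

End bounded_operator_theory.

(** * Cholesky factorization of infinite positive matrices *)

Section cholesky.
Context {R : realType}.
Implicit Types (rho : nat -> nat -> R[i]) (z : nat -> R[i]^o).

Definition matrix_form rho N (u v : nat -> R[i]^o) : R[i] :=
  \sum_(i < N) \sum_(j < N) rho i j * u i * (v j)^*%C.

Definition psd_matrix rho := forall N (z : nat -> R[i]), 0 <= matrix_form rho N z z.

Definition unit_seq m : nat -> R[i]^o := fun i => (i == m)%:R.

Lemma matrix_form_unitr rho N z m : (m < N)%N ->
  matrix_form rho N z (unit_seq m) = \sum_(i < N) rho i m * z i.
Proof.
move=> mN; apply: eq_bigr => i _.
rewrite (bigD1 (Ordinal mN))//= /unit_seq eqxx rmorph1 mulr1 big1 ?addr0// => j jm.
by rewrite (_ : (j == m :> nat) = false) ?rmorph0 ?mulr0//; exact/negbTE.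
Qed.

Lemma matrix_form_unit rho N k m : (k < N)%N -> (m < N)%N ->
  matrix_form rho N (unit_seq k) (unit_seq m) = rho k m.
Proof.
move=> kN mN; rewrite matrix_form_unitr// (bigD1 (Ordinal kN))//= /unit_seq.
rewrite eqxx mulr1 big1 ?addr0// => j jk.
by rewrite (_ : (j == k :> nat) = false) ?mulr0//; exact/negbTE.
Qed.

(** The truncated form is a positive sesquilinear form on the space of all sequences, so the general
    facts apply; unit sequences then give the entries of [rho]. *)
Lemma matrix_form_cs rho N u v : psd_matrix rho ->
  matrix_form rho N v u = (matrix_form rho N u v)^*%C /\
  `|matrix_form rho N u v| ^+ 2 <= matrix_form rho N u u * matrix_form rho N v v.
Proof.
move=> rho0; split; [apply: psd_hermitian|apply: psd_cauchy_schwarz] => //;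
  try (by move=> a; exact: rho0);
  move=> a b c; rewrite /matrix_form -?big_split/= ?big_distrr/=;
  apply: eq_bigr => i _; rewrite -?big_split/= ?big_distrr/=;
  apply: eq_bigr => j _; rewrite !fctE ?conjcD.
all: rewrite ?/GRing.scale/= ?conjcM; ring.
Qed.

Lemma psd_matrix_diag rho m : psd_matrix rho -> 0 <= rho m m.
Proof.
by move=> rho0; rewrite -(@matrix_form_unit rho m.+1 m m)//; exact: rho0.
Qed.

Lemma psd_matrix_herm rho i j : psd_matrix rho -> rho j i = (rho i j)^*%C.
Proof.
move=> rho0; pose N := (maxn i j).+1.
have iN : (i < N)%N by rewrite ltnS leq_maxl.
have jN : (j < N)%N by rewrite ltnS leq_maxr.
have [+ _] := matrix_form_cs N (unit_seq i) (unit_seq j) rho0.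
by rewrite !matrix_form_unit.
Qed.

Lemma psd_matrix_cs rho i j : psd_matrix rho ->
  `|rho i j| ^+ 2 <= rho i i * rho j j.
Proof.
move=> rho0; pose N := (maxn i j).+1.
have iN : (i < N)%N by rewrite ltnS leq_maxl.
have jN : (j < N)%N by rewrite ltnS leq_maxr.
have [_] := matrix_form_cs N (unit_seq i) (unit_seq j) rho0.
by rewrite !matrix_form_unit.
Qed.

(* One step of Gaussian elimination: the rank-one positive matrix with the same
   [m]-th row and column as [rho] is subtracted; division by [rho m m = 0] is
   harmless since that row then vanishes. *)
Definition chol_vec rho m i : R[i] := rho i m / sqrtC (rho m m).

Definition chol_rem rho m i j : R[i] :=
  rho i j - chol_vec rho m i * (chol_vec rho m j)^*%C.

Lemma chol_vecM rho m i j : psd_matrix rho ->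
  chol_vec rho m i * (chol_vec rho m j)^*%C =
  (rho m m)^-1 * (rho i m * (rho j m)^*%C).
Proof.
move=> rho0; have d0 := psd_matrix_diag m rho0.
have s0 : 0 <= (sqrtC (rho m m))^-1 by rewrite invr_ge0 sqrtC_ge0.
rewrite /chol_vec conjcM (conjc_ge0 s0).
rewrite -[in RHS](sqrtCK (rho m m)) expr2 invfM; ring.
Qed.

(** Elimination subtracts [|matrix_form rho N z (unit_seq m)|^2 / rho m m] from the form at [z],
    which Cauchy-Schwarz allows. *)
Lemma chol_rem_psd rho m : psd_matrix rho -> psd_matrix (chol_rem rho m).
Proof.
move=> rho0 N0 z0; pose N := maxn N0 m.+1; have d0 := psd_matrix_diag m rho0.
(* [z0] is padded by 0 up to a size [N > m], so that [unit_seq m] fits in the truncation. *)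
pose z i : R[i] := if (i < N0)%N then z0 i else 0.
have mN : (m < N)%N by rewrite leq_max ltnSn orbT.
have -> : matrix_form (chol_rem rho m) N0 z0 z0 =
    matrix_form (chol_rem rho m) N z z.
  have N0N : (N0 <= N)%N by rewrite leq_maxl.
  rewrite /matrix_form (big_ord_widen N (fun i =>
    \sum_(j < N0) chol_rem rho m i j * z0 i * (z0 j)^*%C) N0N).
  rewrite big_mkcond/=; apply: eq_bigr => i _; rewrite /z.
  case: ifPn => iN; last first.
    by rewrite big1// => j _; rewrite mulr0 mul0r.
  rewrite (big_ord_widen N
    (fun j => chol_rem rho m i j * z0 i * (z0 j)^*%C) N0N).
  rewrite big_mkcond/=; apply: eq_bigr => j _.
  by case: ifPn => // _; rewrite rmorph0 mulr0.
have -> : matrix_form (chol_rem rho m) N z z = matrix_form rho N z z -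
    (rho m m)^-1 * `|matrix_form rho N z (unit_seq m)| ^+ 2.
  rewrite matrix_form_unitr// sqr_normc rmorph_sum/= big_distrlr/= big_distrr/=.
  rewrite -sumrB; apply: eq_bigr => i _.
  rewrite big_distrr/= -sumrB; apply: eq_bigr => j _.
  rewrite /chol_rem chol_vecM// conjcM; ring.
have [_ cs] := matrix_form_cs N z (unit_seq m) rho0.
rewrite matrix_form_unit// in cs.
have [d00|dn0] := eqVneq (rho m m) 0.
  by rewrite d00 invr0 mul0r subr0; exact: rho0.
by rewrite subr_ge0 mulrC ler_pdivrMr// lt0r dn0.
Qed.

(** The indices 0, 1, 2, ... are eliminated in turn. The first [m] rows of the remainder [r m]
    vanish, so row [i] of [rho] is exhausted after [i + 1] steps and every [N > i] gives the same
    finite sum. *)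
Lemma cholesky rho : psd_matrix rho -> exists c : nat -> nat -> R[i],
  (forall m i, (i < m)%N -> c m i = 0) /\
  forall N i j, (i < N)%N ->
    rho i j = \sum_(m < N) c m i * (c m j)^*%C.
Proof.
move=> rho0.
pose r := fix r m := if m is k.+1 then chol_rem (r k) k else rho.
have rpsd m : psd_matrix (r m).
  by elim: m => [|m IH] //=; exact: chol_rem_psd.
have r0 m i j : (i < m)%N -> r m i j = 0.
  elim: m i j => // m IH i j; rewrite ltnS leq_eqVlt /= => /orP[/eqP ->|im].
    rewrite /chol_rem chol_vecM// -(psd_matrix_herm _ _ (rpsd m)).
    have [d0|d0] := eqVneq (r m m m) 0; last by rewrite mulrA mulVf// mul1r subrr.
    (* Zero pivot: nothing is subtracted, but by Cauchy-Schwarz row [m] was already zero. *)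
    rewrite d0 invr0 mul0r subr0; apply/eqP.
    have := psd_matrix_cs m j (rpsd m); rewrite d0 mul0r => rn.
    by rewrite -normr_eq0 -sqrf_eq0 eq_le rn exprn_ge0.
  by rewrite /chol_rem /chol_vec !(IH i _ im) !mul0r subr0.
exists (fun m => chol_vec (r m) m); split.
  by move=> m i im; rewrite /chol_vec r0// mul0r.
move=> N i j iN.
have sumE : r N i j =
    rho i j - \sum_(m < N) chol_vec (r m) m i * (chol_vec (r m) m j)^*%C.
  elim: N {iN} => [|N IH]; first by rewrite big_ord0 subr0.
  by rewrite big_ord_recr/= {1}/chol_rem IH opprD addrA.
by apply/eqP; rewrite -subr_eq0 -sumE r0.
Qed.

End cholesky.

(** * Rearrangement of double sums *)

Section double_series.
Context {R : realType}.
Variable f : nat -> nat * nat.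

Lemma sum_square (G : nat * nat -> R[i]) K N :
  \sum_(k < K) \sum_(m < N) G (k : nat, m : nat) =
  \sum_(p <- [seq (k, m) | k <- iota 0 K, m <- iota 0 N]) G p.
Proof.
rewrite big_allpairs_dep/= -(big_mkord xpredT (fun k => \sum_(m < N) G (k, m : nat))).
rewrite /index_iota subn0; apply: eq_bigr => k _.
by rewrite -(big_mkord xpredT (fun m => G (k, m))) /index_iota subn0.
Qed.

Lemma square_uniq K N : uniq [seq (k, m) | k <- iota 0 K, m <- iota 0 N].
Proof.
apply: allpairs_uniq; rewrite ?iota_uniq//.
by move=> [a b] [c d] _ _ /= [-> ->].
Qed.

Lemma mem_square K N p :
  (p \in [seq (k, m) | k <- iota 0 K, m <- iota 0 N]) =
  (p.1 < K)%N && (p.2 < N)%N.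
Proof.
case: p => k m /=; apply/allpairsP/idP => [[[a b] /= [aK bN [-> ->]]]|/andP[kK mN]].
  by move: aK bN; rewrite !mem_iota /= !add0n => -> ->.
by exists (k, m); rewrite !mem_iota.
Qed.

(** Finitely many distinct pairs lie in a common square, and the further terms are nonnegative. *)
Lemma sum_le_square (G : nat * nat -> R[i]) P : injective f ->
  (forall p, 0 <= G p) ->
  exists K, \sum_(l < P) G (f l) <= \sum_(k < K) \sum_(m < K) G (k : nat, m : nat).
Proof.
move=> finj G0.
pose K := (\max_(l < P) maxn (f l).1 (f l).2).+1; exists K.
rewrite sum_square -(big_mkord xpredT (fun l => G (f l))) /index_iota subn0.
rewrite -(big_map f xpredT); set s := map _ _; 
set s' := [seq (k, m) | k <- iota 0 K, m <- iota 0 K].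
have us : uniq s by rewrite map_inj_uniq ?iota_uniq.
have ss' : {subset s <= s'}.
  move=> p /mapP[l]; rewrite mem_iota add0n => lP ->; rewrite mem_square !ltnS.
  have := leq_bigmax (F := fun l : 'I_P => maxn (f l).1 (f l).2) (Ordinal lP).
  by rewrite geq_max.
rewrite [leRHS](bigID (mem s))/= -[leLHS]addr0; apply: lerD; last exact: sumr_ge0.
rewrite le_eqVlt; apply/orP; left; apply/eqP; rewrite -[RHS]big_filter.
apply: perm_big; apply: uniq_perm => //; first by rewrite filter_uniq// square_uniq.
by move=> p; rewrite mem_filter /=; apply/esym/andb_idr => /ss'.
Qed.

(** Once [Q] exceeds every index that [g] gives to the rectangle, the pairs kept by the cutoff are
    exactly those of the rectangle, each once. *)
Lemma sum_reindex (g : nat * nat -> nat) (G : nat * nat -> R[i]) K N :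
  cancel f g -> cancel g f ->
  exists Q0, forall Q, (Q0 <= Q)%N ->
  \sum_(l < Q) (if ((f l).1 < K)%N && ((f l).2 < N)%N then G (f l) else 0) =
  \sum_(k < K) \sum_(m < N) G (k : nat, m : nat).
Proof.
move=> fK gK; exists (\max_(k < K) \max_(m < N) g (k : nat, m : nat)).+1 => Q Qmax.
rewrite -big_mkcond/= sum_square.
rewrite -(big_mkord (fun l => ((f l).1 < K)%N && ((f l).2 < N)%N)
  (fun l => G (f l))).
rewrite /index_iota subn0.
rewrite -(big_map f (fun p => (p.1 < K)%N && (p.2 < N)%N)) -big_filter.
apply: perm_big; apply: uniq_perm.
- by rewrite filter_uniq// map_inj_uniq ?iota_uniq//; exact: can_inj fK.
- exact: square_uniq.
move=> [k m]; rewrite mem_filter mem_square /=; apply/andb_idr => /andP[kK mN].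
apply/mapP; exists (g (k, m)); last by rewrite gK.
rewrite mem_iota add0n; apply: leq_trans Qmax; rewrite ltnS.
apply: leq_trans (leq_bigmax (Ordinal kK)).
exact: (leq_bigmax (F := fun m : 'I_N => g (k, m : nat)) (Ordinal mN)).
Qed.

End double_series.

Lemma nat_pair_bij : exists (f : nat -> nat * nat) (g : nat * nat -> nat),
  cancel f g /\ cancel g f.
Proof.
have /card_set_bijP[g] : ([set: nat] #= [set: nat * nat])%card.
  by rewrite card_eq_sym; exact: card_nat2.
by rewrite setTT_bijective => -[h gK hK]; exists g, h.
Qed.

(** * Kraus form of the transfer sums *)

Section isometric_family.
Context {R : realType} {H : hilbertType R}.
(* [V i] is an isometry if [P i] holds, and 0 otherwise. *)
Variables (P : pred nat) (V : nat -> BH H).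
Hypothesis VV : forall i j x y,
  '[V i x, V j y] = if (i == j) && P i then '[x, y] else 0.

Lemma adj_family_mul i j :
  adj (V i) * V j = if (i == j) && P i then 1 else 0.
Proof.
apply: BH_eq => x y; rewrite BHE_mul adjopPl VV (eq_sym j).
have [->|ij] := eqVneq i j; last by rewrite inner0l.
by rewrite /=; case: (P j); rewrite ?inner0l.
Qed.

Lemma adj_familyE i j x :
  adj (V i) (V j x) = if (i == j) && P i then x else 0.
Proof. by rewrite -BHE_mul adj_family_mul; case: ifP. Qed.

Lemma norm_family_le i x : `|V i x| <= `|x|.
Proof.
rewrite -(@ler_pXn2r _ 2)// ?nnegrE// -!innerxx VV eqxx /=.
by case: ifP => // _; exact: innerxx_ge0.
Qed.

(** Pythagoras for the pairwise orthogonal vectors [V j x]; only an inequality, because some [V j]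
    may be 0. *)
Lemma sqr_norm_family_sum (r : seq nat) (c : nat -> R[i]) x : uniq r ->
  `|\sum_(j <- r) c j *: V j x| ^+ 2 <= (\sum_(j <- r) `|c j| ^+ 2) * `|x| ^+ 2.
Proof.
move=> ur; rewrite -[leLHS]innerxx inner_suml mulr_suml.
rewrite big_seq [leRHS]big_seq; apply: ler_sum => j jr.
rewrite inner_sumr (bigD1_seq j)//= big1 ?addr0 => [|i ij].
  rewrite innerZl innerZr mulrA -sqr_normc; apply: ler_wpM2l; first exact: exprn_ge0.
  by rewrite innerxx ler_pXn2r ?nnegrE// norm_family_le.
by rewrite innerZl innerZr VV eq_sym (negbTE ij) !mulr0.
Qed.

Variable rho : nat -> nat -> R[i].

Definition transfer_sum N (a : BH H) : BH H :=
  \sum_(i < N) \sum_(j < N) rho i j *: (adj (V i) * a * V j).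

Lemma inner_transfer_sum N a x y :
  '[transfer_sum N a x, y] =
  \sum_(i < N) \sum_(j < N) rho i j * '[a (V j x), V i y].
Proof.
rewrite /transfer_sum BHE_sum inner_suml; apply: eq_bigr => i _.
rewrite BHE_sum inner_suml; apply: eq_bigr => j _.
by rewrite BHE_scale innerZl !BHE_mul adjopPl.
Qed.

Lemma inner_transfer_sum_linear N k (a b : BH H) x y :
  '[transfer_sum N (k *: a + b) x, y] =
  k * '[transfer_sum N a x, y] + '[transfer_sum N b x, y].
Proof.
rewrite !inner_transfer_sum mulr_sumr -big_split/=.
apply: eq_bigr => i _; rewrite mulr_sumr -big_split/=; apply: eq_bigr => j _.
by rewrite innerDl innerZl; ring.
Qed.

Variables (tau : R[i]).
Hypothesis rho_tr : forall N, \sum_(i < N) rho i i <= tau.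

Section kraus.
Variable c : nat -> nat -> R[i].
Hypothesis cE : forall N i j, (i < N)%N ->
  rho i j = \sum_(m < N) c m i * (c m j)^*%C.

(* The partial sums of the m-th Kraus operator [\sum_j (c m j)^* V_j] at [x]. *)
Definition kraus_sum m N x : H := \sum_(0 <= j < N) (c m j)^*%C *: V j x.

(** Exact at every finite stage: for [i < N] the Cholesky sum ends before [N], so the first [N]
    vectors [c m] already factor the N by N corner of [rho]. *)
Lemma kraus_transfer_sum N a x y : '[transfer_sum N a x, y] =
  \sum_(m < N) '[a (kraus_sum m N x), kraus_sum m N y].
Proof.
rewrite inner_transfer_sum.
under [RHS]eq_bigr => m _.
  rewrite /kraus_sum !big_mkord (linear_sum (op a)) inner_suml.
  under eq_bigr => j _.
    rewrite (linearZ_LR (op a)) inner_sumr.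
    under eq_bigr => i _ do rewrite innerZl innerZr conjcK.
    over.
  over.
rewrite exchange_big/= [RHS]exchange_big/=; apply: eq_bigr => j _.
rewrite [RHS]exchange_big/=; apply: eq_bigr => i _.
by rewrite (cE j (ltn_ord i)) mulr_suml; apply: eq_bigr => m _; ring.
Qed.

(** On the enclosing square, summing over [m] first turns column [j] into [rho j j]. *)
Lemma kraus_weight_le M N :
  \sum_(m < M) \sum_(j < N) `|c m j| ^+ 2 <= tau.
Proof.
pose K := maxn M N.
have MK : (M <= K)%N by rewrite leq_maxl.
have NK : (N <= K)%N by rewrite leq_maxr.
have widen (F : nat -> R[i]) (a b : nat) : (a <= b)%N -> (forall i, 0 <= F i) ->
    \sum_(i < a) F i <= \sum_(i < b) F i.
  move=> ab F0; rewrite -!(big_mkord xpredT F) (big_cat_nat (leq0n a) ab)/= lerDl.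
  exact: sumr_ge0.
have c0 m j : 0 <= `|c m j| ^+ 2 by exact: exprn_ge0.
apply: le_trans (rho_tr K).
apply: le_trans (widen (fun m => \sum_(j < N) `|c m j| ^+ 2) _ _ MK _) _.
  by move=> m; exact: sumr_ge0.
apply: (@le_trans _ _ (\sum_(m < K) \sum_(j < K) `|c m j| ^+ 2)).
  by apply: ler_sum => m _; exact: (widen (fun j => `|c m j| ^+ 2)).
rewrite exchange_big/=; apply: ler_sum => j _.
rewrite (cE j (ltn_ord j)) le_eqVlt; apply/orP; left.
by apply/eqP/eq_bigr => m _; rewrite sqr_normc.
Qed.

(** The squared l2 norm of [c m], an upper bound for the squared norm of the m-th Kraus operator. *)
Definition kraus_weight m : R[i] :=
  limn ((fun N => \sum_(0 <= j < N) `|c m j| ^+ 2) : nat -> R[i]^o).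

Lemma kraus_weight_cvg m :
  ((fun N => \sum_(0 <= j < N) `|c m j| ^+ 2) : nat -> R[i]^o) @ \oo -->
  (kraus_weight m : R[i]^o).
Proof.
apply: (@nondecreasing_bounded_cvgn _ _ tau).
- by move=> N; apply: sumr_ge0 => j _; exact: exprn_ge0.
- by move=> N; rewrite big_nat_recr//= lerDl exprn_ge0.
- move=> N; rewrite big_mkord; apply: le_trans (kraus_weight_le m.+1 N).
  rewrite big_ord_recr/= lerDr; apply: sumr_ge0 => k _.
  by apply: sumr_ge0 => j _; exact: exprn_ge0.
Qed.

Lemma kraus_weight_ub m N : \sum_(j < N) `|c m j| ^+ 2 <= kraus_weight m.
Proof.
rewrite -(big_mkord xpredT (fun j => `|c m j| ^+ 2)).
apply: (@nondecreasing_cvgn_ub _ (fun N => \sum_(0 <= j < N) `|c m j| ^+ 2));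
  last exact: kraus_weight_cvg.
move=> k; by rewrite big_nat_recr//= lerDl exprn_ge0.
Qed.

Lemma kraus_weight_ge0 m : 0 <= kraus_weight m.
Proof. by apply: le_trans (kraus_weight_ub m 0); rewrite big_ord0. Qed.

Lemma sum_kraus_weight M : \sum_(m < M) kraus_weight m <= tau.
Proof.
have h := @cvgn_sum _ R[i]^o _ (index_enum 'I_M) xpredT
  (fun (m : 'I_M) N => \sum_(0 <= j < N) `|c m j| ^+ 2)
  (fun m => kraus_weight m) (fun m _ => @kraus_weight_cvg m).
apply: (cvgn_le _ h (cvg_cst (tau : R[i]^o))) => N.
under eq_bigr do rewrite big_mkord; exact: kraus_weight_le.
Qed.

Lemma sqr_norm_kraus_sum m N x :
  `|kraus_sum m N x| ^+ 2 <= kraus_weight m * `|x| ^+ 2.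
Proof.
apply: le_trans (sqr_norm_family_sum _ _ (iota_uniq _ _)) _.
apply: ler_wpM2r; first exact: exprn_ge0.
apply: le_trans (kraus_weight_ub m N).
rewrite -(big_mkord xpredT (fun j => `|c m j| ^+ 2)) /index_iota subn0.
by apply: ler_sum => j _; rewrite normcJ.
Qed.

Lemma kraus_sum_is_cvg m x : cvgn (fun N => kraus_sum m N x).
Proof.
apply: cauchy_seq_cvgn => e e0.
(* The [+ 1] keeps the divisor positive when [x = 0]. *)
have x0 : 0 < `|x| ^+ 2 + 1 by rewrite ltr_wpDl// exprn_ge0.
have e20 : 0 < e ^+ 2 / (`|x| ^+ 2 + 1) by rewrite divr_gt0 ?exprn_gt0.
have [N hN] := nneg_tail (fun j => exprn_ge0 2 (normr_ge0 (c m j)))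
  (kraus_weight_ub m) e20.
exists N => k Nk; rewrite -(@ltr_pXn2r _ 2)// ?nnegrE ?normr_ge0 ?(ltW e0)// distrC.
rewrite /kraus_sum (big_cat_nat (leq0n N) Nk)/= [X in X - _]addrC addrK.
apply: le_lt_trans (sqr_norm_family_sum _ _ (iota_uniq _ _)) _.
rewrite (eq_bigr (fun j => `|c m j| ^+ 2)) => [|j _]; last by rewrite normcJ.
have := hN k; rewrite ltr_pdivlMr// => {}hN.
apply: le_lt_trans hN; apply: ler_wpM2l; last by rewrite lerDl.
by apply: sumr_ge0 => j _; exact: exprn_ge0.
Qed.

Definition kraus m x : H := limn (fun N => kraus_sum m N x).

Lemma sqr_norm_kraus m x : `|kraus m x| ^+ 2 <= kraus_weight m * `|x| ^+ 2.
Proof.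
have tx := @kraus_sum_is_cvg m x.
have h : (fun N => `|kraus_sum m N x| ^+ 2 : R[i]^o) @ \oo -->
    (`|kraus m x| ^+ 2 : R[i]^o).
  by apply: cvgM; apply: cvg_norm; exact: tx.
apply: (cvgn_le _ h (cvg_cst (kraus_weight m * `|x| ^+ 2 : R[i]^o))) => N.
exact: sqr_norm_kraus_sum.
Qed.

Lemma norm_inner_kraus_sum (a : BH H) m N x y :
  `|'[a (kraus_sum m N x), kraus_sum m N y]| <=
  `|a| * (kraus_weight m * (`|x| * `|y|)).
Proof.
apply: le_trans (cauchy_schwarz _ _) _.
apply: le_trans (ler_wpM2r (normr_ge0 _) (le_BHnorm _ _)) _.
rewrite -mulrA; apply: ler_wpM2l => //.
have w0 := kraus_weight_ge0 m.
rewrite -(@ler_pXn2r _ 2)// ?nnegrE ?mulr_ge0// !exprMn.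
rewrite (_ : kraus_weight m ^+ 2 * (`|x| ^+ 2 * `|y| ^+ 2) =
  (kraus_weight m * `|x| ^+ 2) * (kraus_weight m * `|y| ^+ 2)); last by ring.
by apply: ler_pM; rewrite ?exprn_ge0// sqr_norm_kraus_sum.
Qed.

(** Cauchy-Schwarz in each Kraus term, after which the weights add up to at most [tau]. The bound
    does not depend on [N] and so passes to the limit. *)
Lemma norm_transfer_sum N (a : BH H) x y :
  `|'[transfer_sum N a x, y]| <= tau * `|a| * `|x| * `|y|.
Proof.
rewrite kraus_transfer_sum; apply: le_trans (ler_norm_sum _ _ _) _.
apply: (@le_trans _ _ (\sum_(m < N) `|a| * (kraus_weight m * (`|x| * `|y|)))).
  by apply: ler_sum => m _; exact: norm_inner_kraus_sum.
rewrite -mulr_sumr -mulr_suml mulrCA -!mulrA.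
apply: ler_wpM2r; last exact: sum_kraus_weight.
by rewrite !mulr_ge0.
Qed.

Lemma transfer_sum_pos N a : positive_op a -> positive_op (transfer_sum N a).
Proof.
by move=> a0 x; rewrite kraus_transfer_sum; apply: sumr_ge0 => m _; exact: a0.
Qed.

End kraus.
End isometric_family.

(** A product of two nonnegative numbers is at most the square of the larger one, hence at most the
    sum of both squares. *)
Lemma sum_norm_mul_le (R : realType) (H : hilbertType R) (x y : nat -> H)
    (X Y : R[i]) :
  (forall n, \sum_(k < n) `|x k| ^+ 2 <= X) ->
  (forall n, \sum_(k < n) `|y k| ^+ 2 <= Y) -> forall n,
  \sum_(k < n) `|x k| * `|y k| <= X + Y.
Proof.
move=> xX yY n; apply: le_trans (lerD (xX n) (yY n)); rewrite -big_split/=.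
apply: ler_sum => k _; have xk := normr_ge0 (x k); have yk := normr_ge0 (y k).
have [xy|xy] := orP (real_leVge (ger0_real xk) (ger0_real yk)).
  apply: (@le_trans _ _ (`|y k| ^+ 2)); last by rewrite lerDr exprn_ge0.
  by rewrite expr2 ler_wpM2r.
apply: (@le_trans _ _ (`|x k| ^+ 2)); last by rewrite lerDl exprn_ge0.
by rewrite expr2 ler_wpM2l.
Qed.

(** * Pulling sigma-weak functionals back through a map in Kraus form *)

Section normality.
Context {R : realType} {H : hilbertType R}.
Variables (P : pred nat) (V : nat -> BH H).
Hypothesis VV : forall i j x y,
  '[V i x, V j y] = if (i == j) && P i then '[x, y] else 0.
Variables (rho : nat -> nat -> R[i]) (tau : R[i]) (c : nat -> nat -> R[i]).
Hypotheses (rho_tr : forall N, \sum_(i < N) rho i i <= tau)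
  (cE : forall N i j, (i < N)%N -> rho i j = \sum_(m < N) c m i * (c m j)^*%C).
Variable L : BH H -> BH H.
Hypothesis LE : forall a, wot_cvg (transfer_sum V rho ^~ a) (L a).

Local Notation kraus := (kraus V c).
Local Notation kraus_sum := (kraus_sum V c).
Local Notation kraus_weight := (kraus_weight c).

Lemma cvg_inner_kraus (a : BH H) m x y :
  (fun N => '[a (kraus_sum m N x), kraus_sum m N y] : R[i]^o) @ \oo -->
  ('[a (kraus m x), kraus m y] : R[i]^o).
Proof.
have kc z : (fun N => kraus_sum m N z) @ \oo --> kraus m z.
  exact: (kraus_sum_is_cvg VV rho_tr cE).
apply: cvg_inner; last exact: kc.
by apply: cvg_comp (kc x) _; exact: BH_continuous.
Qed.

Variables (f : nat -> nat * nat) (g : nat * nat -> nat).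
Hypotheses (fK : cancel f g) (gK : cancel g f).
Variables (x y : nat -> H) (X Y : R[i]).
Hypotheses (xX : forall n, \sum_(k < n) `|x k| ^+ 2 <= X)
           (yY : forall n, \sum_(k < n) `|y k| ^+ 2 <= Y).

(** Over a square containing the first [n] pairs the sum factors into a sum of weights and a sum of
    [u]. *)
Lemma sum_reindex_le (u : nat -> R[i]) (M : R[i]) : 0 <= M ->
  (forall k, 0 <= u k) ->
  (forall n, \sum_(k < n) u k <= M) ->
  forall n, \sum_(l < n) kraus_weight (f l).2 * u (f l).1 <= tau * M.
Proof.
move=> M0 u0 uM n.
have w0 m : 0 <= kraus_weight m by exact: (kraus_weight_ge0 rho_tr cE).
have [K] := sum_le_square n (can_inj fK)
  (fun p : nat * nat => mulr_ge0 (w0 p.2) (u0 p.1)).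
move=> /le_trans; apply; rewrite exchange_big/=.
under eq_bigr do rewrite -mulr_sumr.
rewrite -mulr_suml.
apply: ler_pM; [exact: sumr_ge0|exact: sumr_ge0| |exact: uM].
exact: (sum_kraus_weight rho_tr cE).
Qed.

Let w l := kraus (f l).2 (x (f l).1).
Let v l := kraus (f l).2 (y (f l).1).

Let X0 : 0 <= X. Proof. by apply: le_trans (xX 0); rewrite big_ord0. Qed.
Let Y0 : 0 <= Y. Proof. by apply: le_trans (yY 0); rewrite big_ord0. Qed.

Lemma kraus_seq_le n :
  \sum_(l < n) `|kraus (f l).2 (x (f l).1)| ^+ 2 <= tau * X.
Proof.
apply: le_trans (sum_reindex_le X0 (fun k => exprn_ge0 2 (normr_ge0 (x k))) xX n).
by apply: ler_sum => l _; exact: (sqr_norm_kraus VV rho_tr cE).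
Qed.

(** Tannery's theorem is used twice with the one majorant [d]: first [N], which truncates both the
    Kraus operators and their number, goes to infinity for fixed [K]; then [K] does. *)
Lemma sigma_weak_form_transfer (a : BH H) :
  (fun K => \sum_(0 <= k < K) '[L a (x k), y k] : R[i]^o) @ \oo -->
  sigma_weak_form (w, v) a.
Proof.
pose d l := `|a| * (kraus_weight (f l).2 * (`|x (f l).1| * `|y (f l).1|)).
have w0 m : 0 <= kraus_weight m by exact: (kraus_weight_ge0 rho_tr cE).
have d0 l : 0 <= d l by rewrite !mulr_ge0.
have dM n : \sum_(l < n) d l <= `|a| * (tau * (X + Y)).
  rewrite -mulr_sumr ler_wpM2l//.
  apply: (@sum_reindex_le (fun k => `|x k| * `|y k|) _ (addr_ge0 X0 Y0) _
    (sum_norm_mul_le xX yY)) => k.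
  exact: mulr_ge0.
pose G K l : R[i]^o := if ((f l).1 < K)%N then '[a (w l), v l] else 0.
have kle m s t N : `|'[a (kraus_sum m N s), kraus_sum m N t]| <=
    `|a| * (kraus_weight m * (`|s| * `|t|)).
  exact: (norm_inner_kraus_sum VV rho_tr cE).
have wle l : `|'[a (w l), v l]| <= d l.
  by apply: cvgn_norm_le (@cvg_inner_kraus a _ _ _) => N; exact: kle.
have GE K : limn (series (G K)) = \sum_(0 <= k < K) '[L a (x k), y k].
  pose F N (p : nat * nat) : R[i] :=
    '[a (kraus_sum p.2 N (x p.1)), kraus_sum p.2 N (y p.1)].
  (* Enumerated over pairs, the limit in [N] is the series of [G K]; regrouped by [k], it is the sum
     of the ['[L a (x k), y k]]. Uniqueness of limits equates the two. *)
  pose GN N l : R[i]^o :=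
    if ((f l).1 < K)%N && ((f l).2 < N)%N then F N (f l) else 0.
  have lGN N : limn (series (GN N)) =
      \sum_(k < K) '[transfer_sum V rho N a (x k), y k].
    have [Q0 hQ] := sum_reindex (F N) K N fK gK.
    apply: lim_near_cst => //; exists Q0 => // Q /= /hQ.
    rewrite /series/= big_mkord => ->; apply: eq_bigr => k _.
    by rewrite (kraus_transfer_sum V cE).
  have lim1 : (fun N => limn (series (GN N))) @ \oo --> limn (series (G K)).
    apply: (tannery _ dM) => [N l|l].
      by rewrite /GN; case: ifPn => _; [exact: kle|rewrite normr0].
    rewrite /GN /G; case: ifP => lK /=; last exact: cvg_cst.
    apply: cvg_trans (@cvg_inner_kraus a (f l).2 (x (f l).1) (y (f l).1)).
    apply: near_eq_cvg; exists (f l).2.+1 => // N /= lN.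
    by rewrite lN.
  have lim2 : (fun N => limn (series (GN N))) @ \oo -->
      (\sum_(k < K) '[L a (x k), y k] : R[i]^o).
    under eq_fun do rewrite lGN.
    by apply: cvgn_sum => k _; exact: LE.
  rewrite big_mkord.
  exact: (cvg_unique (@norm_hausdorff _ _) lim1 lim2).
rewrite (_ : (fun K => _) = (fun K => limn (series (G K)))); last first.
  by apply/funext => K; rewrite GE.
apply: (tannery _ dM) => [K l|l].
  by rewrite /G; case: ifP => _; [exact: wle|rewrite normr0].
apply: (@cvg_trans _ (cst ('[a (w l), v l] : R[i]^o) @ \oo)); last exact: cvg_cst.
by apply: near_eq_cvg; exists (f l).1.+1 => // K /= lK; rewrite /G lK.
Qed.

End normality.

(** * The sigma-weak topology *)

Section sigma_weak_topology.
Context {R : realType} {H : hilbertType R}.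

Lemma square_summableP (x : nat -> H) : square_summable x <->
  exists X : R[i], forall n, \sum_(k < n) `|x k| ^+ 2 <= X.
Proof.
split => [/cvg_ex[X xX]|[X xX]].
  exists X => n; rewrite -(big_mkord xpredT (fun k => `|x k| ^+ 2)).
  apply: (@nondecreasing_cvgn_ub _ ([series `|x k| ^+ 2]_k : nat -> R[i]^o)) => // k.
  by rewrite /series/= big_nat_recr//= lerDl exprn_ge0.
apply: (@nondecreasing_bounded_cvgn _ _ X) => n.
- by apply: sumr_ge0 => k _; exact: exprn_ge0.
- by rewrite /series/= big_nat_recr//= lerDl exprn_ge0.
- by rewrite /series/= big_mkord.
Qed.

Lemma sigma_weak_form_continuous (xy : @l2_pair R H) :
  continuous (sigma_weak_form (sval xy) : sigma_weak H -> R[i]^o).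
Proof.
move=> a A /= Aa.
have h := @cvg_sup (BH H) _ (fun xy : @l2_pair R H =>
  Topological.on (initial_topology (sigma_weak_form (sval xy))))
  (nbhs (a : sigma_weak H)) a (@nbhs_filter (sigma_weak H) a).
apply: (h.1 (@cvg_id _ (nbhs (a : sigma_weak H))) xy).
exact: initial_continuous.
Qed.

Lemma cvg_initial (Y : choiceType) (Z : topologicalType) (w : Y -> Z)
    (F : set_system Y) (s : Y) : Filter F ->
  w @ F --> w s -> F --> (s : initial_topology w).
Proof.
move=> FF h U [/= _ [[W oW <-] Ws]] /filterS; apply; apply: h.
exact: open_nbhs_nbhs.
Qed.

(** The universal property of initial topologies: continuity into the target need only be tested on
    the generating functionals. *)
Lemma normal_mapP (L : BH H -> BH H) :
  (forall xy : @l2_pair R H, exists zw : @l2_pair R H,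
    forall a, sigma_weak_form (sval xy) (L a) = sigma_weak_form (sval zw) a) ->
  normal_map L.
Proof.
move=> h a; apply/(@cvg_sup _ _ _ _ _
  (fmap_filter _ (nbhs_filter (a : sigma_weak H)))) => xy.
have [zw E] := h xy.
apply: cvg_initial.
move=> A; rewrite E => /(@sigma_weak_form_continuous zw a) zA.
apply: (@filterS _ _ (nbhs_filter (a : sigma_weak H)) _ _ _ zA) => b /=.
by rewrite E.
Qed.

(** For a bounded sequence the series defining a functional is dominated by [M |x k| |y k|], so
    termwise limits suffice. *)
Lemma cvg_sigma_weak (a_ : nat -> BH H) (a : BH H) (M : R[i]) :
  (forall n, `|a_ n| <= M) -> wot_cvg a_ a ->
  (a_ : nat -> sigma_weak H) @ \oo --> (a : sigma_weak H).
Proof.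
move=> aM aw; apply/(@cvg_sup _ _ _ _ _ (fmap_filter _ eventually_filter)).
move=> [[x y] [/= xs ys]].
have [X xX] := (square_summableP x).1 xs.
have [Y yY] := (square_summableP y).1 ys.
have M0 : 0 <= M by apply: le_trans (aM 0%N).
apply: cvg_initial; rewrite /sigma_weak_form /=.
apply: (@tannery _ (fun N k => '[a_ N (x k), y k]) _
  (fun k => M * (`|x k| * `|y k|)) (M * (X + Y))).
- move=> N k; apply: le_trans (cauchy_schwarz _ _) _; rewrite mulrA.
  apply: ler_wpM2r => //; apply: le_trans (le_BHnorm _ _) _.
  exact: ler_wpM2r.
- by move=> n; rewrite -mulr_sumr ler_wpM2l// sum_norm_mul_le.
- by move=> k; exact: aw.
Qed.

Lemma sigma_weak_cvg_wot (a_ : nat -> BH H) (a : BH H) :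
  (a_ : nat -> sigma_weak H) @ \oo --> (a : sigma_weak H) -> wot_cvg a_ a.
Proof.
move=> ca x y.
(* ['[b x, y]] is the sigma-weak functional of the sequences [x, 0, 0, ...] and [y, 0, 0, ...]. *)
pose d (z : H) (k : nat) : H := if k is 0%N then z else 0.
have dE (F : nat -> R[i]^o) : (forall k, F k.+1 = 0) ->
    forall n, series F n.+1 = F 0%N.
  move=> F0 n; rewrite /series /= big_nat_recl//= big1 ?addr0//.
have ds z : square_summable (d z).
  apply/square_summableP; exists (`|z| ^+ 2) => -[|n].
    by rewrite big_ord0 exprn_ge0.
  rewrite big_ord_recl big1/= ?addr0// => k _.
  by rewrite normr0 expr0n.
pose xy : @l2_pair R H := exist _ (d x, d y) (conj (ds x) (ds y)).
have E b : sigma_weak_form (sval xy) b = '[b x, y].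
  apply: lim_near_cst => //; exists 1%N => // -[//|n] _ /=; apply: dE => k.
  by rewrite (linear0 (op b)) inner0l.
rewrite -E (_ : (fun N => _) = sigma_weak_form (sval xy) \o a_); last first.
  by apply/funext => N; rewrite /= E.
apply: cvg_comp ca _; exact: sigma_weak_form_continuous.
Qed.

End sigma_weak_topology.

(** * Transfer operators *)

Section operator_complements.
Context {R : realType} {H : hilbertType R}.
Implicit Types (a b : BH H) (k : R[i]).

Lemma BHZl k a b : (k *: a) * b = k *: (a * b). Proof. exact: BHP. Qed.

Lemma BHZr k a b : a * (k *: b) = k *: (a * b).
Proof. by apply: BHP => x; exact: (linearZ_LR (op a)). Qed.

Lemma adjop_sum I (r : seq I) (P : pred I) (f : I -> BH H) :
  adj (\sum_(i <- r | P i) f i) = \sum_(i <- r | P i) adj (f i).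
Proof. exact: (big_morph _ adjopD adjop0). Qed.

Lemma BHnorm_le a (M : R[i]) : 0 <= M ->
  (forall x y, `|'[a x, y]| <= M * `|x| * `|y|) -> `|a| <= M.
Proof.
move=> M0 aM; have ME : M = (complex.Re M)%:C by rewrite RRe_real// ger0_real.
rewrite ME lecR; apply: opnorm_le => x x1; rewrite -lecR -normRe -ME.
have [->|ax] := eqVneq (a x) 0; first by rewrite normr0.
have ax0 : 0 < `|a x| by rewrite normr_gt0.
rewrite -(ler_pM2r ax0) -expr2 -innerxx.
apply: le_trans (_ : `|'[a x, a x]| <= _); first by rewrite ger0_norm ?innerxx_ge0.
apply: le_trans (aM _ _) _; rewrite ler_wpM2r//.
by rewrite -[leRHS]mulr1 ler_wpM2l.
Qed.

Lemma isometry_adj a : isometry_op a -> adj a * a = 1.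
Proof.
by move=> ai; apply: BH_eq_diag => x; rewrite BHE_mul adjopPl !innerxx ai.
Qed.

Lemma wot_cvg_unique (a_ : nat -> BH H) a b :
  wot_cvg a_ a -> wot_cvg a_ b -> a = b.
Proof.
move=> ca cb; apply: BH_eq => x y.
exact: (cvg_unique (@norm_hausdorff _ _) (ca x y) (cb x y)).
Qed.

Lemma positive_op_adj a : positive_op a -> adj a = a.
Proof.
move=> a0; apply: BH_eq_diag => x.
by rewrite adjopPl innerC (conjc_ge0 (a0 x)).
Qed.

Lemma positive_op_adj_mul a : positive_op (a * adj a).
Proof. by move=> x; rewrite BHE_mul adjopP; exact: innerxx_ge0. Qed.

(** Serves to write a self-adjoint operator as a difference of two positive ones. *)
Lemma selfadjoint_add_norm a : adj a = a -> positive_op (a + `|a| *: (1 : BH H)).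
Proof.
move=> aa x; rewrite BHE_add BHE_scale innerDl innerZl innerxx.
have ar : '[a x, x] \is Num.real.
  by apply/CrealP; rewrite conjE -innerC adjopP aa.
have : - '[a x, x] <= `|a| * `|x| ^+ 2.
  apply: le_trans (real_ler_norm _) _; first by rewrite realN.
  rewrite normrN; apply: le_trans (cauchy_schwarz _ _) _.
  by rewrite expr2 mulrA ler_wpM2r// le_BHnorm.
by rewrite -subr_ge0 opprK addrC.
Qed.

Lemma rank_one_ex (x e : H) : exists t : BH H, forall y, t y = '[y, e] *: x.
Proof.
pose f : H -> H := fun y => '[y, e] *: x.
have tl : linear f.
  by move=> k u v; rewrite /f innerDl innerZl scalerDl scalerA.
have fM y : `|f y| <= `|x| * `|e| * `|y|.
  rewrite normrZ mulrC -mulrA; apply: ler_wpM2l => //.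
  by rewrite mulrC; exact: cauchy_schwarz.
have fc : continuous f.
  exact: (linear_le_continuous (mulr_ge0 (normr_ge0 x) (normr_ge0 e)) tl fM).
have fb : f \in @bounded_op R H by rewrite inE.
by exists (Bounded fb).
Qed.

(** Commutation with the rank one operator [y |-> '[y, e] *: x], evaluated at [e], gives [b x =
    '[b e, e] *: x]. *)
Lemma central_scalar b (e : H) : `|e| = 1 -> (forall a, a * b = b * a) ->
  b = '[b e, e] *: (1 : BH H).
Proof.
move=> e1 bc; apply: BHP => x; rewrite BHE_scale BHE_one.
have [t tE] := rank_one_ex x e.
have := congr1 (fun a : BH H => a e) (bc t).
by rewrite !BHE_mul !tE innerxx e1 expr1n scale1r.
Qed.

(** A positive linear map preserves self-adjointness, by differences of positive operators; the
    general case follows from the decomposition [b = (h - i k) / 2] with [h] and [k]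
    self-adjoint. *)
Lemma positive_map_adj (L : BH H -> BH H) b : linear L -> positive_map L ->
  L (adj b) = adj (L b).
Proof.
move=> Ll Lp; pose fL : {linear BH H -> BH H} :=
  HB.pack L (GRing.isLinear.Build R[i] (BH H) (BH H) *:%R L Ll).
have LD a c : L (a + c) = L a + L c by exact: (linearD fL).
have LB a c : L (a - c) = L a - L c by exact: (linearB fL).
have LZ k a : L (k *: a) = k *: L a by exact: (linearZ_LR fL).
have sa h : adj h = h -> adj (L h) = L h.
  move=> hh.
  have -> : h = (h + `|h| *: (1 : BH H)) - `|h| *: (1 : BH H) by rewrite addrK.
  rewrite LB LZ adjopB adjopZ conjc_ge0//.
  congr (_ - _ *: _); apply: positive_op_adj; apply: Lp.
    exact: selfadjoint_add_norm.
  by move=> x; exact: innerxx_ge0.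
have iJ := conjc_i R.
have ii : 'i%C * 'i%C = -1 :> R[i] by rewrite -expr2 sqr_i.
pose h := b + adj b; pose k : BH H := 'i%C *: (b - adj b).
have hE : adj (L h) = L h by apply: sa; rewrite adjopD adjopK addrC.
have kE : adj (L k) = L k.
  by apply: sa; rewrite adjopZ iJ adjopB adjopK -opprB scaleNr scalerN opprK.
have half (u : BH H) : u = 2%:R^-1 *: (u + u).
  rewrite scalerDr -scalerDl (_ : 2%:R^-1 + 2%:R^-1 = 1 :> R[i]) ?scale1r//.
  by field.
have ik : 'i%C *: k = - (b - adj b) by rewrite scalerA ii scaleN1r.
have bE : b = 2%:R^-1 *: (h - 'i%C *: k).
  by rewrite [LHS]half /h ik opprK addrACA subrr addr0.
have bE' : adj b = 2%:R^-1 *: (h + 'i%C *: k).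
  by rewrite [LHS]half /h ik opprB [adj b - b]addrC addrACA subrr add0r.
have -> : L (adj b) = 2%:R^-1 *: (L h + 'i%C *: L k) by rewrite -LZ -LD -LZ -bE'.
have -> : L b = 2%:R^-1 *: (L h - 'i%C *: L k) by rewrite -LZ -LB -LZ -bE.
by rewrite adjopZ adjopB adjopZ hE kE iJ conjc_ge0 ?invr_ge0 ?ler0n// scaleNr opprK.
Qed.

End operator_complements.

(** * Intertwining relations between the endomorphism and its isometries *)

Section transfer_operators.
Context {R : realType} {H : hilbertType R}.
Variables (P : pred nat) (V : nat -> BH H) (alpha : BH H -> BH H).
Hypothesis VV : forall i j x y,
  '[V i x, V j y] = if (i == j) && P i then '[x, y] else 0.
Hypothesis alphaE : endomorphism alpha.
Hypothesis alphaV : forall a,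
  wot_cvg (fun N => \sum_(i < N) V i * a * adj (V i)) (alpha a).

Lemma family_off i : ~~ P i -> V i = 0.
Proof.
move=> iP; apply: BHP => x; apply/eqP; rewrite -innerxx_eq0 VV (negbTE iP) andbF.
exact: eqxx.
Qed.

(** On the range of [V i] only the term of index [i] survives, so the partial sums of [alpha a] are
    constant there once [N > i]. *)
Lemma endo_mul_family a i : alpha a * V i = V i * a.
Proof.
have [iP|iP] := boolP (P i); last by rewrite family_off// mulr0 mul0r.
apply: BH_eq => x y; rewrite !BHE_mul.
suff h : (fun N => '[(\sum_(k < N) V k * a * adj (V k)) (V i x), y] : R[i]^o)
    @ \oo --> ('[V i (a x), y] : R[i]^o).
  exact: (cvg_unique (@norm_hausdorff _ _) (@alphaV a (V i x) y) h).
apply: (@cvg_trans _ (cst ('[V i (a x), y] : R[i]^o) @ \oo)); last exact: cvg_cst.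
apply: near_eq_cvg; exists i.+1 => // N /= iN.
rewrite BHE_sum inner_suml (bigD1 (Ordinal iN))//= big1 ?addr0 => [|j ji].
  by rewrite (adj_familyE VV) eqxx iP.
rewrite (adj_familyE VV).
rewrite (_ : (j == i :> nat) = false); last exact/negbTE.
by rewrite /= (linear0 (op a)) (linear0 (op (V j))) inner0l.
Qed.

Lemma adj_family_mul_endo a i : adj (V i) * alpha a = a * adj (V i).
Proof.
have [_ _ alphaJ] := alphaE.
by rewrite -[alpha a]adjopK -alphaJ -adjopM endo_mul_family adjopM adjopK.
Qed.

(** * From a positive trace class matrix to a normal transfer operator *)

Section from_matrix.
Variables (rho : nat -> nat -> R[i]) (tau : R[i]) (L : BH H -> BH H).
Hypotheses (rho_psd : psd_matrix rho)
  (rho_tr : (fun N => \sum_(i < N) rho i i : R[i]^o) @ \oo --> (tau : R[i]^o))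
  (rho_off : forall i, ~~ P i -> rho i i = 0)
  (LE : forall a, wot_cvg (transfer_sum V rho ^~ a) (L a)).

Let rho_le N : \sum_(i < N) rho i i <= tau.
Proof.
apply: (@nondecreasing_cvgn_ub _ (fun N => \sum_(i < N) rho i i)) => // k.
by rewrite big_ord_recr/= lerDl psd_matrix_diag.
Qed.

Let tau0 : 0 <= tau.
Proof. by apply: le_trans (rho_le 0); rewrite big_ord0. Qed.

Lemma transfer_linear : linear L.
Proof.
move=> k a b; apply: (wot_cvg_unique (@LE _)) => x y.
rewrite BHE_add BHE_scale innerDl innerZl.
rewrite (_ : (fun N => _) = (fun N => k * '[transfer_sum V rho N a x, y] +
    '[transfer_sum V rho N b x, y] : R[i]^o)).
  by apply: cvgD; [apply: cvgM; [exact: cvg_cst|exact: @LE]|exact: @LE].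
by apply/funext => N; exact: inner_transfer_sum_linear.
Qed.

Lemma transfer_norm_le a : `|L a| <= tau * `|a|.
Proof.
have [c [_ cE]] := cholesky rho_psd.
apply: BHnorm_le => [|x y]; first exact: mulr_ge0.
apply: (cvgn_norm_le _ (@LE a x y)) => N.
exact: (norm_transfer_sum VV rho_le cE).
Qed.

Lemma transfer_positive : positive_map L.
Proof.
have [c [_ cE]] := cholesky rho_psd.
move=> a a0 x; apply: (cvgn_ge0 _ (@LE a x x)) => N.
exact: (transfer_sum_pos V cE).
Qed.

Lemma transfer_mul_endo a b : L (alpha a * b) = a * L b.
Proof.
apply: (wot_cvg_unique (@LE _)) => x y.
(* The factor [a] moves to the other side as [adj a], where the weak limit for [b] applies. *)
rewrite BHE_mul adjopP (_ : (fun N => _) =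
  (fun N => '[transfer_sum V rho N b x, adj a y] : R[i]^o)); first exact: @LE.
apply/funext => N; rewrite -adjopP -BHE_mul.
suff -> : transfer_sum V rho N (alpha a * b) = a * transfer_sum V rho N b by [].
rewrite /transfer_sum mulr_sumr; apply: eq_bigr => i _.
rewrite mulr_sumr; apply: eq_bigr => j _.
by rewrite BHZr !mulrA adj_family_mul_endo.
Qed.

Lemma transfer_normal : normal_map L.
Proof.
have [c [_ cE]] := cholesky rho_psd.
have [f [g [fK gK]]] := nat_pair_bij.
apply: normal_mapP => -[[x y] [/= xs ys]].
have [X xX] := (square_summableP x).1 xs.
have [Y yY] := (square_summableP y).1 ys.
pose w (u : nat -> H) l := kraus V c (f l).2 (u (f l).1).
have ws (u : nat -> H) (M : R[i]) : (forall n, \sum_(k < n) `|u k| ^+ 2 <= M) ->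
    square_summable (w u).
  move=> uM; apply/square_summableP; exists (tau * M).
  exact: (kraus_seq_le VV rho_le cE fK uM).
exists (exist _ (w x, w y) (conj (ws _ _ xX) (ws _ _ yY))) => a /=.
apply: (cvg_lim (@norm_hausdorff _ R[i]^o)).
exact: (sigma_weak_form_transfer VV rho_le cE (@LE) fK gK xX yY).
Qed.

Lemma normal_transfer : normal_transfer_operator alpha L.
Proof.
split; last exact: transfer_normal.
split; [exact: transfer_linear| |exact: transfer_positive|exact: transfer_mul_endo].
exact: (linear_le_continuous tau0 (@transfer_linear) (@transfer_norm_le)).
Qed.

Lemma transfer_one : L 1 = tau *: (1 : BH H).
Proof.
apply: (wot_cvg_unique (@LE 1)) => x y.
rewrite BHE_scale BHE_one innerZl (_ : (fun N => _) =
  (fun N => (\sum_(i < N) rho i i) * '[x, y] : R[i]^o)).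
  by apply: cvgM; [exact: rho_tr|exact: cvg_cst].
apply/funext => N; rewrite inner_transfer_sum mulr_suml; apply: eq_bigr => i _.
rewrite (bigD1 i)//= big1 ?addr0 => [|j ji].
  (* Where [V i] is 0, [rho_off] makes the diagonal entry 0 too, so the whole trace is recovered. *)
  rewrite VV eqxx /=; case: ifPn => // /rho_off ->.
  by rewrite !mul0r.
by rewrite VV (_ : (j == i :> nat) = false) ?mulr0//; exact/negbTE.
Qed.

(** The bound [tau] is attained at the identity, which has norm 1 because a unit vector exists. *)
Lemma transfer_opnorm : (exists e : H, `|e| = 1) -> (opnorm L)%:C = tau.
Proof.
move=> [e e1].
have n1 : `|1 : BH H| = 1.
  apply/eqP; rewrite eq_le; apply/andP; split.
    by apply: BHnorm_le => // x y; rewrite mul1r; exact: cauchy_schwarz.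
  by have := le_BHnorm 1 e; rewrite BHE_one e1 mulr1.
have tE : tau = (complex.Re tau)%:C by rewrite RRe_real// ger0_real.
have Lle (a : BH H) : `|a| <= 1 -> complex.Re `|L a| <= complex.Re tau.
  move=> a1; rewrite -lecR -tE -(normRe (L a)).
  by apply: le_trans (transfer_norm_le a) _; rewrite -[leRHS]mulr1 ler_wpM2l.
apply/eqP; rewrite eq_le; apply/andP; split.
  rewrite tE lecR; apply: ge_sup.
    by exists (complex.Re `|L 0|), 0 => //=; rewrite normr0.
  by move=> _ [a /= a1 <-]; exact: Lle.
rewrite [leLHS]tE lecR; apply: sup_upper_bound.
  split; first by exists (complex.Re `|L 0|), 0 => //=; rewrite normr0.
  by exists (complex.Re tau) => _ [a /= a1 <-]; exact: Lle.
exists 1; first by rewrite /= n1.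
by rewrite transfer_one normrZ n1 mulr1 ger0_norm.
Qed.

(** The condition reads [tau *: alpha 1 = alpha 1], and [alpha 1] is nonzero by multiplicativity. *)
Lemma transfer_nondegenerate : (exists a, alpha a <> 0) ->
  nondegenerate_transfer alpha L <-> tau = 1.
Proof.
move=> [a a0]; have [alphal alphaM _] := alphaE.
have alphaZ k b : alpha (k *: b) = k *: alpha b.
  pose f : {linear BH H -> BH H} :=
    HB.pack alpha (GRing.isLinear.Build R[i] (BH H) (BH H) *:%R alpha alphal).
  exact: (linearZ_LR f).
have a1 : alpha 1 != 0.
  by apply/eqP => h; apply: a0; rewrite -[a]mul1r alphaM h mul0r.
rewrite /nondegenerate_transfer transfer_one alphaZ.
split => [h|->]; last exact: scale1r.
apply/eqP; rewrite -subr_eq0; have : (tau - 1) *: alpha 1 == 0.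
  by rewrite scalerBl h scale1r subrr.
by rewrite scaler_eq0 (negbTE a1) orbF.
Qed.

End from_matrix.

(** * From a normal transfer operator to its matrix *)

Section to_matrix.
Variables (L : BH H -> BH H) (e : H).
Hypotheses (e1 : `|e| = 1) (LN : normal_transfer_operator alpha L).

Let Ll : linear L. Proof. by case: LN => -[]. Qed.
Let Lpos : positive_map L. Proof. by case: LN => -[]. Qed.
Let Ltr a b : L (alpha a * b) = a * L b. Proof. by case: LN => -[]. Qed.

Let fL : {linear BH H -> BH H} :=
  HB.pack L (GRing.isLinear.Build R[i] (BH H) (BH H) *:%R L Ll).

Let Lsum I (r : seq I) (Q : pred I) (f : I -> BH H) :
  L (\sum_(i <- r | Q i) f i) = \sum_(i <- r | Q i) L (f i).
Proof. exact: (linear_sum fL). Qed.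

Let LZ k a : L (k *: a) = k *: L a.
Proof. exact: (linearZ_LR fL). Qed.

(** The adjoint of the transfer identity, as [L] and [alpha] both commute with [adj]. *)
Lemma transfer_mul_endor a b : L (b * alpha a) = L b * a.
Proof.
have [_ _ alphaJ] := alphaE.
rewrite -[b * _]adjopK positive_map_adj// adjopM -alphaJ Ltr adjopM adjopK.
by rewrite positive_map_adj// adjopK.
Qed.

(** [L (V i * adj (V j))] will turn out to be scalar; the unit vector [e] reads off its value. *)
Definition transfer_matrix i j := '[L (V i * adj (V j)) e, e].

Lemma transfer_matrixE i j : L (V i * adj (V j)) = transfer_matrix i j *: (1 : BH H).
Proof.
apply: central_scalar => // a; rewrite -Ltr -transfer_mul_endor.
by rewrite mulrA endo_mul_family -!mulrA adj_family_mul_endo.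
Qed.

Lemma transfer_corner i j a : L (V i * a * adj (V j)) = transfer_matrix i j *: a.
Proof.
by rewrite -endo_mul_family -mulrA Ltr transfer_matrixE BHZr mulr1.
Qed.

Lemma transfer_matrix_off i j : ~~ P i || ~~ P j -> transfer_matrix i j = 0.
Proof.
rewrite /transfer_matrix => h.
have -> : V i * adj (V j) = 0.
  by case/orP: h => h; rewrite (family_off h) ?adjop0 ?mul0r ?mulr0.
by rewrite -(scale0r 0) LZ scale0r inner0l.
Qed.

Lemma transfer_matrix_psd : psd_matrix transfer_matrix.
Proof.
move=> N z.
pose T : BH H := \sum_(i < N) z i *: V i.
have -> : matrix_form transfer_matrix N z z = '[L (T * adj T) e, e].
  rewrite /T adjop_sum mulr_suml Lsum BHE_sum inner_suml; apply: eq_bigr => i _.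
  rewrite mulr_sumr Lsum BHE_sum inner_suml; apply: eq_bigr => j _.
  rewrite BHZl adjopZ BHZr scalerA LZ BHE_scale innerZl /transfer_matrix; ring.
by apply: Lpos; exact: positive_op_adj_mul.
Qed.

Definition range_proj N : BH H := \sum_(i < N) V i * adj (V i).

Lemma range_proj_adj N : adj (range_proj N) = range_proj N.
Proof.
by rewrite /range_proj adjop_sum; apply: eq_bigr => i _; rewrite adjopM adjopK.
Qed.

Lemma range_proj_idem N : range_proj N * range_proj N = range_proj N.
Proof.
rewrite {1}/range_proj mulr_suml; apply: eq_bigr => i _.
rewrite /range_proj mulr_sumr (bigD1 i)//= big1 ?addr0 => [|j ji].
  have [iP|iP] := boolP (P i); last by rewrite (family_off iP) !mul0r.
  by rewrite !mulrA -[V i * _ * V i]mulrA (adj_family_mul VV) eqxx iP mulr1.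
rewrite !mulrA -[V i * _ * V j]mulrA (adj_family_mul VV).
rewrite (_ : (i == j :> nat) = false) ?mulr0 ?mul0r//.
by apply/negbTE; rewrite eq_sym.
Qed.

Lemma range_proj_compl N : positive_op (1 - range_proj N).
Proof.
move=> x; have : (1 - range_proj N) * adj (1 - range_proj N) = 1 - range_proj N.
  rewrite adjopB adjop1 range_proj_adj mulrBr mulr1 mulrBl mul1r range_proj_idem.
  by rewrite subrr subr0.
by move=> <-; exact: positive_op_adj_mul.
Qed.

Lemma norm_range_proj N x : `|range_proj N x| <= `|x|.
Proof.
rewrite -(@ler_pXn2r _ 2)// ?nnegrE// -!innerxx.
rewrite -{2}(range_proj_adj N) -adjopP -BHE_mul range_proj_idem.
by have := range_proj_compl N x; rewrite BHE_add BHE_opp BHE_one innerBl subr_ge0.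
Qed.

Lemma transfer_matrix_trace N : \sum_(i < N) transfer_matrix i i <= '[L 1 e, e].
Proof.
have -> : \sum_(i < N) transfer_matrix i i = '[L (range_proj N) e, e].
  by rewrite Lsum BHE_sum inner_suml.
rewrite -subr_ge0 -innerBl -BHE_opp -BHE_add.
have -> : L 1 - L (range_proj N) = L (1 - range_proj N).
  by symmetry; exact: (linearB fL).
exact: (Lpos (range_proj_compl N)).
Qed.

(** Weak convergence becomes strong here: as [range_proj N] is a projection below [alpha 1], the
    squared distance is ['[alpha 1 x, x] - '[range_proj N x, x]]. *)
Lemma range_proj_cvg x : (fun N => range_proj N x) @ \oo --> alpha 1 x.
Proof.
have [_ alphaM alphaJ] := alphaE.
have wk : (fun N => '[range_proj N x, x] : R[i]^o) @ \oo -->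
    ('[alpha 1 x, x] : R[i]^o).
  have := @alphaV 1 x x.
  rewrite (_ : (fun N => _) = (fun N => '[range_proj N x, x])) //.
  apply/funext => N; rewrite /range_proj.
  by rewrite (eq_bigr (fun i : 'I_N => V i * adj (V i))) // => i _; rewrite mulr1.
have pN N : alpha 1 * range_proj N = range_proj N.
  rewrite /range_proj mulr_sumr; apply: eq_bigr => i _.
  by rewrite mulrA endo_mul_family mulr1.
have Np N : range_proj N * alpha 1 = range_proj N.
  by rewrite -[RHS]range_proj_adj -[in RHS]pN adjopM range_proj_adj -alphaJ adjop1.
have dist N : `|alpha 1 x - range_proj N x| ^+ 2 =
    '[alpha 1 x, x] - '[range_proj N x, x].
  rewrite -innerxx -BHE_opp -BHE_add -{2}[alpha 1 - _]adjopK -adjopP -BHE_mul.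
  rewrite adjopB range_proj_adj -alphaJ adjop1 mulrBl !mulrBr pN Np range_proj_idem.
  by rewrite -alphaM mulr1 subrr subr0 innerBl.
apply/cvgrPdist_le => eps eps0.
have /cvgrPdist_le/(_ _ (exprn_gt0 2 eps0))[N0 _ hN] := wk.
exists N0 => // N /hN; rewrite -dist ger0_norm ?exprn_ge0//.
by rewrite ler_pXn2r ?nnegrE// ltW.
Qed.

Lemma transfer_matrix_transfer b :
  wot_cvg (transfer_sum V transfer_matrix ^~ b) (L b).
Proof.
pose p := alpha 1.
have -> : L b = L (p * b * p) by rewrite transfer_mul_endor Ltr mul1r mulr1.
pose b_ N := range_proj N * b * range_proj N.
have bL N : transfer_sum V transfer_matrix N b = L (b_ N).
  rewrite /b_ /range_proj mulr_suml mulr_suml Lsum; apply: eq_bigr => i _.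
  rewrite mulr_sumr Lsum; apply: eq_bigr => j _.
  rewrite -transfer_corner; congr L.
  by rewrite !mulrA.
rewrite (_ : (fun N => _) = L \o b_); last by apply/funext => N; rewrite bL.
apply: sigma_weak_cvg_wot.
have cb : (b_ : nat -> sigma_weak H) @ \oo --> (p * b * p : sigma_weak H).
  have pin N (u v : H) : '[range_proj N u, v] = '[u, range_proj N v].
    by rewrite adjopP range_proj_adj.
  apply: (@cvg_sigma_weak _ _ b_ _ `|b|) => [N|x y].
    apply: BHnorm_le => // x y; rewrite !BHE_mul pin.
    apply: le_trans (cauchy_schwarz _ _) _.
    apply: ler_pM => //; last exact: norm_range_proj.
    apply: le_trans (le_BHnorm _ _) _; rewrite ler_wpM2l//.
    exact: norm_range_proj.
  have pJ : adj p = p by have [_ _ alphaJ] := alphaE; rewrite -alphaJ adjop1.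
  rewrite !BHE_mul adjopP pJ (_ : (fun N => _) =
    (fun N => '[b (range_proj N x), range_proj N y] : R[i]^o)); last first.
    by apply/funext => N; rewrite !BHE_mul pin.
  apply: cvg_inner; last exact: range_proj_cvg.
  by apply: cvg_comp (@range_proj_cvg x) _; exact: BH_continuous.
(* Normality of [L] enters here, carrying the sigma-weak convergence of [b_] over to [L \o b_]. *)
apply: cvg_comp cb _; case: LN => _; exact.
Qed.

End to_matrix.

End transfer_operators.

Theorem theorem3p3 (R : realType) (H : hilbertType R)
    (Hsep : separable H) (Hinf : ~ finite_dimensional H)
    (alpha : BH H -> BH H) (Halpha : endomorphism alpha)
    (Halpha0 : exists a : BH H, alpha a <> 0)
    (n : option nat) (Hn : n <> Some 0%N)
    (U : nat -> BH H)
    (HUiso : forall i : nat, below n i -> isometry_op (U i))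
    (HUorth : forall i j : nat, below n i -> below n j -> i <> j ->
       orthogonal_ranges (U i) (U j))
    (HU : implements n U alpha) :
  (forall L : BH H -> BH H,
     normal_transfer_operator alpha L <->
     exists rho : nat -> nat -> R[i],
       positive_trace_class n rho /\ transfer_form n U rho L) /\
  (forall (L : BH H -> BH H) (rho : nat -> nat -> R[i]),
     positive_trace_class n rho -> transfer_form n U rho L ->
     (opnorm L)%:C = trace n rho /\
     (nondegenerate_transfer alpha L <-> trace n rho = 1)).
Proof.
(* Padding the families by 0 turns all index sets into [nat]. *)
pose V i : BH H := if below n i then U i else 0.
have VV i j x y :
    '[V i x, V j y] = if (i == j) && below n i then '[x, y] else 0.
  rewrite /V; case: ifPn => ni; last by rewrite andbF inner0l.
  have [<-|ij] /= := eqVneq i j.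
    by rewrite ni -adjopPl -BHE_mul isometry_adj//; exact: HUiso.
  by case: ifPn => nj; rewrite ?inner0r// HUorth//; exact/eqP.
have alphaV a : wot_cvg (fun N => \sum_(i < N) V i * a * adj (V i)) (alpha a).
  have := HU a; congr (wot_cvg _ _); apply/funext => N.
  rewrite big_mkcond; apply: eq_bigr => i _; rewrite /V.
  by case: ifP => // _; rewrite !mul0r.
(* A nonzero value of [alpha] forces [H] to be nonzero. *)
have [e e1] : exists e : H, `|e| = 1.
  have [a a0] := Halpha0.
  have [x x0] : exists x : H, x != 0.
    apply: contra_notP a0 => h; apply: BHP => x; apply: contra_notP h => xn.
    by exists (alpha a x); apply/eqP.
  by exists (`|x|^-1 *: x); rewrite normrZ normfV normr_id mulVf// normr_eq0.
pose ext (rho : nat -> nat -> R[i]) i j : R[i] :=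
  if below n i && below n j then rho i j else 0.
have form_ext rho (L : BH H -> BH H) : transfer_form n U rho L <->
    forall a, wot_cvg (transfer_sum V (ext rho) ^~ a) (L a).
  suff E a : (fun N => \sum_(i < N | below n i) \sum_(j < N | below n j)
                rho i j *: (adj (U i) * a * U j)) = (transfer_sum V (ext rho) ^~ a).
    by split => h a; have := h a; rewrite E.
  apply/funext => N; rewrite /transfer_sum big_mkcond; apply: eq_bigr => i _.
  rewrite /ext /V; case: ifP => _; last by rewrite big1// => j _; rewrite scale0r.
  rewrite big_mkcond; apply: eq_bigr => j _.
  by case: ifP => _ //=; rewrite scale0r.
have psd_ext rho : positive_matrix n rho <-> psd_matrix (ext rho).
  suff E N (z : nat -> R[i]) : \sum_(i < N | below n i) \sum_(j < N | below n j)
      rho i j * z i * (z j)^*%C = matrix_form (ext rho) N z z.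
    by split => h N z; have := h N z; rewrite E.
  rewrite /matrix_form big_mkcond; apply: eq_bigr => i _.
  rewrite /ext; case: ifP => _; last by rewrite big1// => j _; rewrite !mul0r.
  rewrite big_mkcond; apply: eq_bigr => j _.
  by case: ifP => _ //=; rewrite !mul0r.
have trace_ext rho : trace_seq n rho = (fun N => \sum_(i < N) ext rho i i).
  apply/funext => N; rewrite /trace_seq big_mkcond; apply: eq_bigr => i _.
  by rewrite /ext andbb.
have ext_off rho i : ~~ below n i -> ext rho i i = 0.
  by rewrite /ext => /negbTE ->.
have data rho : positive_trace_class n rho -> psd_matrix (ext rho) /\
    (fun N => \sum_(i < N) ext rho i i : R[i]^o) @ \oo -->
    (trace n rho : R[i]^o).
  by move=> [/psd_ext rho0 rhoT]; split => //; rewrite -trace_ext; exact: rhoT.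
split=> [L|L rho /data[rho0 rhoT] /form_ext LE]; last first.
  split.
    apply: (transfer_opnorm VV rho0 rhoT (@ext_off rho) LE).
    by exists e.
  exact: (transfer_nondegenerate VV Halpha rhoT (@ext_off rho) LE Halpha0).
split=> [LN|[rho [/data[rho0 rhoT] /form_ext LE]]]; last first.
  exact: (normal_transfer VV Halpha alphaV rho0 rhoT LE).
pose rho := transfer_matrix V L e.
(* The matrix built from [V] already vanishes off the index set, so it is its own padding. *)
have rhoE : ext rho = rho.
  apply/funext => i; apply/funext => j; rewrite /ext.
  case: ifPn => //; rewrite negb_and => ij; apply/esym.
  exact: (transfer_matrix_off VV e LN).
exists rho; split; last first.
  apply/form_ext => a; rewrite rhoE.
  exact: (transfer_matrix_transfer VV Halpha alphaV e1 LN).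
have rho0 : psd_matrix rho by exact: (transfer_matrix_psd V e LN).
split; first by apply/psd_ext; rewrite rhoE.
rewrite trace_ext rhoE.
apply: (@nondecreasing_bounded_cvgn _ _ '[L 1 e, e]) => N.
- by apply: sumr_ge0 => i _; exact: psd_matrix_diag.
- by rewrite big_ord_recr/= lerDl psd_matrix_diag.
- exact: (transfer_matrix_trace VV e LN).
Qed.
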